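(* Let $a,b,c\in\mathbb R$, $c\neq0$, and let $(u_1,u_2,p_{u_1},p_{u_2})$ be canonical coordinates on $T^*\mathbb R^2$. Let $\hat u_1,\hat u_2$ be the roots $x$ of the polynomial $$\left(a-\frac{(u_1^2p_{u_1}-u_2^2p_{u_2})^2}{(u_1-u_2)^2}\right)x^2+\frac{bu_1u_2+c(u_1+u_2)}{u_1^2u_2^2}\,x+\frac{c}{u_1u_2},$$ and let $$\hat p_{u_i}=-\hat u_i^{-3}Q(\hat u_i),\qquad Q(x)=x\left(\frac{(x-u_2)u_1^2p_{u_1}}{u_1-u_2}+\frac{(x-u_1)u_2^2p_{u_2}}{u_2-u_1}\right),\qquad 2\lambda_i=\hat u_i^3\hat p_{u_i}^2-a\hat u_i-\frac{b}{\hat u_i^2}-\frac{c}{\hat u_i^3},\quad i=1,2.$$ Then: 1. $\{\hat u_i,\hat p_{u_j}\}=\delta_{ij}$ and $\{\hat u_1,\hat u_2\}=\{\hat p_{u_1},\hat p_{u_2}\}=0$. 2. The functions $$\hat H_1=\frac{u_1^3\bigl(bu_1u_2+c(3u_1+u_2)\bigr)p_{u_1}^2}{c(u_1-u_2)}+\frac{u_2^3\bigl(bu_1u_2+c(u_1+3u_2)\bigr)p_{u_2}^2}{c(u_2-u_1)}-a\left(\frac{bu_1u_2}{c}+3(u_1+u_2)\right)$$ $$+\frac{b^2(u_1+u_2)}{cu_1u_2}+\frac{b(u_1+2u_2)(2u_1+u_2)}{u_1^2u_2^2}+\frac{c(u_1+u_2)(u_1^2+3u_1u_2+u_2^2)}{u_1^3u_2^3},$$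 $$\hat H_2=\left(\frac{u_1^3u_2^3(u_1^2p_{u_1}-u_2^2p_{u_2})^2}{c(u_1-u_2)^2}-\frac{au_1^3u_2^3}{c}+\frac{b^2u_1^2u_2^2}{4c^2}+\frac{b(u_1+u_2)u_1u_2}{2c}+\frac{(u_1+u_2)^2}{4}\right)$$ $$\times\frac{4}{(u_1-u_2)^2}\left(a(u_1-u_2)+b\left(\frac1{u_1^2}-\frac1{u_2^2}\right)+c\left(\frac1{u_1^3}-\frac1{u_2^3}\right)-u_1^3p_{u_1}^2+u_2^3p_{u_2}^2\right)^2$$ satisfy $\hat H_1=2(\lambda_1+\lambda_2)$ and $\hat H_2=4(\lambda_1-\lambda_2)^2$. Consequently $\hat H_1$ is integrable, with second integral $\hat H_2$ a polynomial of sixth order in the momenta: $\{\hat H_1,\hat H_2\}=0$. 3. The Hamiltonian vector field of $\hat H_1$ (with respect to $\{\cdot,\cdot\}$) is bi-Hamiltonian with respect to the compatible Poisson brackets $\{\cdot,\cdot\}$ and $\{\cdot,\cdot\}'$, where $\{\hat u_i,\hat p_{u_j}\}'=\lambda_i^{-1}\delta_{ij}$, $\{\hat u_1,\hat u_2\}'=\{\hat p_{u_1},\hat p_{u_2}\}'=0$.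
   Context: The bracket $\{\cdot,\cdot\}$ is the canonical one, $\{u_i,p_{u_j}\}=\delta_{ij}$, $\{u_1,u_2\}=\{p_{u_1},p_{u_2}\}=0$. Two Poisson brackets are compatible if every linear combination of them is a Poisson bracket; a vector field is bi-Hamiltonian with respect to two compatible brackets if it is Hamiltonian (with possibly different Hamiltonian functions) for both. ''Integrable'' means that $\hat H_1,\hat H_2$ are functionally independent and in involution. Everything is understood locally at generic points, where all expressions are defined ($u_1\neq u_2$, $u_1u_2\ne0$, nonzero leading coefficient, $\hat u_1,\hat u_2$ nonzero and distinct, $\lambda_i\neq0$), with smooth local branches of $\hat u_i$ chosen; complex values are allowed. *)

(* Defs.v *)
From Stdlib Require Import Reals.
From Coquelicot Require Import Coquelicot.

Open Scope R_scope.

Inductive idx := I1 | I2.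

(* The point ((u1, u2), (p1, p2)) of T*R^2. *)
Definition phase : Type := ((R * R) * (R * R))%type.

Definition u (i : idx) (z : phase) : R :=
  match i with I1 => fst (fst z) | I2 => snd (fst z) end.

Definition p (i : idx) (z : phase) : R :=
  match i with I1 => fst (snd z) | I2 => snd (snd z) end.

Inductive coord := Pos (i : idx) | Mom (i : idx).

Definition get (k : coord) (z : phase) : R :=
  match k with Pos i => u i z | Mom i => p i z end.

Definition set (k : coord) (z : phase) (t : R) : phase :=
  match k with
  | Pos I1 => ((t, u I2 z), (p I1 z, p I2 z))
  | Pos I2 => ((u I1 z, t), (p I1 z, p I2 z))
  | Mom I1 => ((u I1 z, u I2 z), (t, p I2 z))
  | Mom I2 => ((u I1 z, u I2 z), (p I1 z, t))
  end.

Definition rpartial (k : coord) (f : phase -> R) (z : phase) : R :=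
  Derive (fun t => f (set k z t)) (get k z).

Definition ex_rpartial (k : coord) (f : phase -> R) (z : phase) : Prop :=
  ex_derive (fun t => f (set k z t)) (get k z).

(* Observables are complex valued, the variables stay real. *)
Definition partial (k : coord) (f : phase -> C) (z : phase) : C :=
  (rpartial k (fun y => Re (f y)) z, rpartial k (fun y => Im (f y)) z).

Definition ex_partial (k : coord) (f : phase -> C) (z : phase) : Prop :=
  ex_rpartial k (fun y => Re (f y)) z /\ ex_rpartial k (fun y => Im (f y)) z.

(* Class C^n on U; only meant for open U. *)
Fixpoint class_C (n : nat) (U : phase -> Prop) (f : phase -> C) : Prop :=
  (forall z, U z -> continuous f z) /\
  match n with
  | O => True
  | S m => forall k : coord,
      (forall z, U z -> ex_partial k f z) /\ class_C m U (partial k f)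
  end.

Definition smooth (U : phase -> Prop) (f : phase -> C) : Prop :=
  forall n, class_C n U f.

Definition bracket : Type := (phase -> C) -> (phase -> C) -> phase -> C.

(* A Poisson bracket on the algebra of smooth complex-valued functions on U.
   Functions on U are represented by total functions, whose values outside U
   are irrelevant by [pb_local]. *)
Record is_poisson_bracket (U : phase -> Prop) (br : bracket) : Prop := {
  pb_smooth : forall f g, smooth U f -> smooth U g -> smooth U (br f g);
  pb_local : forall f f' g g',
    smooth U f -> smooth U f' -> smooth U g -> smooth U g' ->
    (forall z, U z -> f z = f' z) -> (forall z, U z -> g z = g' z) ->
    forall z, U z -> br f g z = br f' g' z;
  pb_linear : forall (s t : C) f g h, smooth U f -> smooth U g -> smooth U h ->
    forall z, U z ->
    br (fun y => s * f y + t * g y)%C h z = (s * br f h z + t * br g h z)%C;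
  pb_skew : forall f g, smooth U f -> smooth U g ->
    forall z, U z -> br f g z = (- br g f z)%C;
  pb_leibniz : forall f g h, smooth U f -> smooth U g -> smooth U h ->
    forall z, U z ->
    br (fun y => f y * g y)%C h z = (f z * br g h z + br f h z * g z)%C;
  pb_jacobi : forall f g h, smooth U f -> smooth U g -> smooth U h ->
    forall z, U z ->
    (br f (br g h) z + br g (br h f) z + br h (br f g) z)%C = 0
}.

Definition canonical : bracket := fun f g z =>
  ((partial (Pos I1) f z * partial (Mom I1) g z
    - partial (Mom I1) f z * partial (Pos I1) g z)
   + (partial (Pos I2) f z * partial (Mom I2) g z
      - partial (Mom I2) f z * partial (Pos I2) g z))%C.

Definition compatible (U : phase -> Prop) (br br' : bracket) : Prop :=
  is_poisson_bracket U br /\ is_poisson_bracket U br' /\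
  forall s t : C,
    is_poisson_bracket U (fun f g z => s * br f g z + t * br' f g z)%C.

(* Vector fields are represented as derivations of functions. *)
Definition vector_field : Type := (phase -> C) -> phase -> C.

Definition hamiltonian_field (br : bracket) (H : phase -> C) : vector_field :=
  fun f => br f H.

Definition is_hamiltonian
    (U : phase -> Prop) (br : bracket) (X : vector_field) : Prop :=
  exists H, smooth U H /\
    forall f, smooth U f -> forall z, U z -> X f z = hamiltonian_field br H f z.

Definition bi_hamiltonian
    (U : phase -> Prop) (br br' : bracket) (X : vector_field) : Prop :=
  compatible U br br' /\ is_hamiltonian U br X /\ is_hamiltonian U br' X.

Definition in_involution (U : phase -> Prop) (F G : phase -> R) : Prop :=
  forall z, U z -> canonical (fun y => RtoC (F y)) (fun y => RtoC (G y)) z = 0.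

Definition independent_at (F G : phase -> R) (z : phase) : Prop :=
  forall s t : R,
    (forall k, s * rpartial k F z + t * rpartial k G z = 0) -> s = 0 /\ t = 0.

(* The differentials are linearly independent on a dense subset of U. *)
Definition functionally_independent
    (U : phase -> Prop) (F G : phase -> R) : Prop :=
  forall V : phase -> Prop, open V -> (exists z, V z) ->
    (forall z, V z -> U z) -> exists z, V z /\ independent_at F G z.

Definition integrable_with (U : phase -> Prop) (F G : phase -> R) : Prop :=
  functionally_independent U F G /\ in_involution U F G.

Definition regular (z : phase) : Prop :=
  u I1 z <> u I2 z /\ u I1 z <> 0 /\ u I2 z <> 0.

(* Total degree exactly n in (p_1, p_2), the coefficients being functions of
   (u_1, u_2); [regular z] only constrains the positions. *)
Definition polynomial_in_momenta (n : nat) (F : phase -> R) : Prop :=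
  exists h : nat -> nat -> R * R -> R,
    (forall z, regular z ->
       F z = sum_f_R0 (fun j => sum_f_R0 (fun k =>
               h j k (fst z) * p I1 z ^ j * p I2 z ^ k) (n - j)) n) /\
    (forall z, regular z ->
       exists j, (j <= n)%nat /\ h j (n - j)%nat (fst z) <> 0).

Definition lead (a : R) (z : phase) : R :=
  let u1 := u I1 z in let u2 := u I2 z in
  let p1 := p I1 z in let p2 := p I2 z in
  a - (u1 ^ 2 * p1 - u2 ^ 2 * p2) ^ 2 / (u1 - u2) ^ 2.

Definition quadratic (a b c : R) (z : phase) (x : C) : C :=
  let u1 := u I1 z in let u2 := u I2 z in
  (lead a z * x ^ 2
   + (b * u1 * u2 + c * (u1 + u2)) / (u1 ^ 2 * u2 ^ 2) * x
   + c / (u1 * u2))%C.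

Definition Q (z : phase) (x : C) : C :=
  let u1 := u I1 z in let u2 := u I2 z in
  let p1 := p I1 z in let p2 := p I2 z in
  (x * ((x - u2) * u1 ^ 2 * p1 / (u1 - u2)
        + (x - u1) * u2 ^ 2 * p2 / (u2 - u1)))%C.

(* Two distinct roots of a polynomial with nonzero leading coefficient of degree
   two are all its roots. *)
Definition root_branches
    (a b c : R) (U : phase -> Prop) (uh : idx -> phase -> C) : Prop :=
  open U /\
  (forall i, smooth U (uh i)) /\
  (forall z, U z ->
     regular z /\ lead a z <> 0 /\
     (forall i, quadratic a b c z (uh i z) = 0 /\ uh i z <> 0) /\
     uh I1 z <> uh I2 z).

Definition ph (uh : idx -> phase -> C) (i : idx) (z : phase) : C :=
  (- (/ (uh i z ^ 3) * Q z (uh i z)))%C.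

Definition lambda
    (a b c : R) (uh : idx -> phase -> C) (i : idx) (z : phase) : C :=
  let x := uh i z in
  ((x ^ 3 * ph uh i z ^ 2 - a * x - b / x ^ 2 - c / x ^ 3) / 2)%C.

Definition Hhat1 (a b c : R) (z : phase) : R :=
  let u1 := u I1 z in let u2 := u I2 z in
  let p1 := p I1 z in let p2 := p I2 z in
  u1 ^ 3 * (b * u1 * u2 + c * (3 * u1 + u2)) * p1 ^ 2 / (c * (u1 - u2))
  + u2 ^ 3 * (b * u1 * u2 + c * (u1 + 3 * u2)) * p2 ^ 2 / (c * (u2 - u1))
  - a * (b * u1 * u2 / c + 3 * (u1 + u2))
  + b ^ 2 * (u1 + u2) / (c * u1 * u2)
  + b * (u1 + 2 * u2) * (2 * u1 + u2) / (u1 ^ 2 * u2 ^ 2)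
  + c * (u1 + u2) * (u1 ^ 2 + 3 * u1 * u2 + u2 ^ 2) / (u1 ^ 3 * u2 ^ 3).

Definition Hhat2 (a b c : R) (z : phase) : R :=
  let u1 := u I1 z in let u2 := u I2 z in
  let p1 := p I1 z in let p2 := p I2 z in
  (u1 ^ 3 * u2 ^ 3 * (u1 ^ 2 * p1 - u2 ^ 2 * p2) ^ 2 / (c * (u1 - u2) ^ 2)
   - a * u1 ^ 3 * u2 ^ 3 / c
   + b ^ 2 * u1 ^ 2 * u2 ^ 2 / (4 * c ^ 2)
   + b * (u1 + u2) * u1 * u2 / (2 * c)
   + (u1 + u2) ^ 2 / 4)
  * (4 / (u1 - u2) ^ 2)
  * (a * (u1 - u2) + b * (1 / u1 ^ 2 - 1 / u2 ^ 2)
     + c * (1 / u1 ^ 3 - 1 / u2 ^ 3)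
     - u1 ^ 3 * p1 ^ 2 + u2 ^ 3 * p2 ^ 2) ^ 2.

Definition delta (i j : idx) : C :=
  match i, j with I1, I1 | I2, I2 => 1 | _, _ => 0 end.

(* Main.v *)
Require Import Defs.
From Stdlib Require Import Reals Lra Lia.
From Coquelicot Require Import Coquelicot.
Open Scope R_scope.

(** Everything is expressed through [y_i = 1 / uh_i] and the rational functions
    [s = (u1^2 p1 - u2^2 p2) / (u1 - u2)], [r = u1 u2 (u1 p1 - u2 p2) / (u1 - u2)],
    [e = 1 / (u1 u2)], [sg = b / c + 1 / u1 + 1 / u2] and [t = (a - s^2) / (c e)]:
    the [y_i] are the roots of [y^2 + sg y + t], the new momenta are
    [r y_i^2 - s y_i], and the five functions generate a Poisson algebra with
    [{sg, r} = 1], [{e, s} = - e], [{t, s} = t], [{t, e} = - 2 s / c], the other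
    brackets being zero.  Implicit differentiation of the quadratic then gives the
    canonical relations, and [Hhat1], [Hhat2] are symmetric functions of the [y_i],
    so that their involution is an identity in this algebra, valid on all regular
    points.

    A family of four commuting derivations [X_i], [Y_i] makes
    [mu_1 X_1 /\ Y_1 + mu_2 X_2 /\ Y_2] a Poisson bracket as soon as [X_j], [Y_j]
    kill [mu_i] for [j <> i].  This applies to the coordinate derivatives and to
    [X_i = {., ph_i}], [Y_i = {uh_i, .}]; the canonical bracket is the case
    [mu_i = 1], the second bracket is [mu_i = 1 / lambda_i], and the Hamiltonian
    of the field for the latter is [lambda_1^2 + lambda_2^2].

    Independence: at fixed positions, a 2 x 2 minor of the differentials is a
    polynomial in the momenta whose leading coefficient in [p1] or in [p2] does
    not vanish. *)

(** * Partial derivatives of complex-valued functions *)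

Lemma C_ext (x y : C) : Re x = Re y -> Im x = Im y -> x = y.
Proof. destruct x, y; simpl; intros; subst; reflexivity. Qed.

Lemma get_set (k : coord) (z : phase) (t : R) : get k (set k z t) = t.
Proof. now destruct k as [[]|[]]. Qed.

Lemma set_get (k : coord) (z : phase) : set k z (get k z) = z.
Proof. now destruct z as [[] []], k as [[]|[]]. Qed.

Lemma set_set (k : coord) (z : phase) (s t : R) : set k (set k z s) t = set k z t.
Proof. now destruct k as [[]|[]]. Qed.

Lemma get_set_neq (k l : coord) (z : phase) (t : R) :
  k <> l -> get l (set k z t) = get l z.
Proof. destruct k as [[]|[]], l as [[]|[]]; easy. Qed.

Lemma set_set_comm (k l : coord) (z : phase) (s t : R) :
  k <> l -> set l (set k z s) t = set k (set l z t) s.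
Proof. destruct k as [[]|[]], l as [[]|[]]; easy. Qed.

Lemma coord_eq_dec (k l : coord) : {k = l} + {k <> l}.
Proof. decide equality; decide equality. Defined.

Lemma continuous_pair {T V W : UniformSpace} (f : T -> V) (g : T -> W) (x : T) :
  continuous f x -> continuous g x -> continuous (fun y => (f y, g y)) x.
Proof.
  intros Hf Hg. apply (continuous_comp_2 f g (fun a b => (a, b))); trivial.
  apply continuous_ext with (fun y => y); [now intros []|apply continuous_id].
Qed.

Lemma continuous_Re_Im {T : UniformSpace} (f : T -> C) (x : T) :
  continuous f x <->
  continuous (fun y => Re (f y)) x /\ continuous (fun y => Im (f y)) x.
Proof.
  split.
  - intros Hf; split; apply (continuous_comp f); trivial;
      destruct (f x); [apply continuous_fst|apply continuous_snd].
  - intros [H1 H2].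
    apply continuous_ext with (fun y => (Re (f y), Im (f y)));
      [now intros y; destruct (f y)|].
    exact (continuous_pair _ _ _ H1 H2).
Qed.

Lemma continuous_get (k : coord) (z : phase) : continuous (get k) z.
Proof.
  assert (Hu : continuous (fst : phase -> R * R) z)
    by (destruct z; apply continuous_fst).
  assert (Hp : continuous (snd : phase -> R * R) z)
    by (destruct z; apply continuous_snd).
  assert (H1 : forall w : R * R, continuous (fst : R * R -> R) w)
    by (intros []; apply continuous_fst).
  assert (H2 : forall w : R * R, continuous (snd : R * R -> R) w)
    by (intros []; apply continuous_snd).
  destruct k as [[]|[]].
  - exact (continuous_comp _ _ _ Hu (H1 _)).
  - exact (continuous_comp _ _ _ Hu (H2 _)).
  - exact (continuous_comp _ _ _ Hp (H1 _)).
  - exact (continuous_comp _ _ _ Hp (H2 _)).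
Qed.

(** Continuity is joint in the point and in the inserted value; the two-parameter slices used for
    the symmetry of second derivatives rely on it. *)
Lemma continuous_set (k : coord) (y : phase * R) :
  continuous (fun y : phase * R => set k (fst y) (snd y)) y.
Proof.
  assert (Ht : continuous (fun y : phase * R => snd y) y)
    by (destruct y; apply continuous_snd).
  assert (Hg : forall l, continuous (fun y : phase * R => get l (fst y)) y).
  { intros l. apply (continuous_comp (fun y : phase * R => fst y) (get l)).
    - destruct y; apply continuous_fst.
    - apply continuous_get. }
  pose proof (Hg (Pos I1)). pose proof (Hg (Pos I2)).
  pose proof (Hg (Mom I1)). pose proof (Hg (Mom I2)).
  destruct k as [[]|[]]; repeat apply @continuous_pair; assumption.
Qed.

(** An open set of phase space meets each coordinate line in a neighbourhood of the base point, so
    identities valid on [U] may be differentiated along that line. *)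
Lemma locally_set (U : phase -> Prop) (k : coord) (z : phase) :
  open U -> U z -> locally (get k z) (fun t => U (set k z t)).
Proof.
  intros HU Hz.
  apply (continuous_comp_2 (fun _ : R => z) (fun t : R => t) (set k)).
  - apply continuous_const.
  - apply continuous_id.
  - apply (continuous_set k (z, get k z)).
  - rewrite set_get. now apply HU.
Qed.

(** Carries existence and value together, whereas [partial] is total and returns a meaningless value
    through [Derive] where no derivative exists. *)
Definition is_partial (k : coord) (f : phase -> C) (z : phase) (d : C) : Prop :=
  is_derive (fun t => Re (f (set k z t))) (get k z) (Re d) /\
  is_derive (fun t => Im (f (set k z t))) (get k z) (Im d).

Lemma is_partial_unique k f z d : is_partial k f z d -> partial k f z = d.
Proof.
  intros [H1 H2]. apply C_ext; now apply is_derive_unique.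
Qed.

Lemma ex_partial_correct k f z : ex_partial k f z -> is_partial k f z (partial k f z).
Proof. intros [H1 H2]. split; now apply Derive_correct. Qed.

Lemma is_partial_ex k f z d : is_partial k f z d -> ex_partial k f z.
Proof. intros [H1 H2]. split; eexists; eassumption. Qed.

Lemma is_partial_ext (U : phase -> Prop) k f g z d :
  open U -> U z -> (forall z, U z -> f z = g z) ->
  is_partial k f z d -> is_partial k g z d.
Proof.
  intros HU Hz Hfg [H1 H2].
  split; (eapply is_derive_ext_loc; [|eassumption]);
    apply filter_imp with (2 := locally_set U k z HU Hz);
    intros t Ht; now rewrite Hfg.
Qed.

Lemma is_partial_const k (w : C) z : is_partial k (fun _ => w) z 0.
Proof. split; apply is_derive_Reals, derivable_pt_lim_const. Qed.

Lemma is_partial_get k l z :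
  is_partial k (fun y => RtoC (get l y)) z
    (if coord_eq_dec k l then 1 else 0).
Proof.
  split; simpl; destruct (coord_eq_dec k l) as [->|Hkl]; simpl.
  - apply is_derive_ext with (fun t => t); [intros t; now rewrite get_set|].
    apply is_derive_Reals, derivable_pt_lim_id.
  - apply is_derive_ext with (fun t => get l z);
      [intros t; now rewrite get_set_neq|].
    apply is_derive_Reals, derivable_pt_lim_const.
  - apply is_derive_Reals, derivable_pt_lim_const.
  - apply is_derive_Reals, derivable_pt_lim_const.
Qed.

Lemma is_partial_plus k (f g : phase -> C) z (df dg : C) :
  is_partial k f z df -> is_partial k g z dg ->
  is_partial k (fun y => f y + g y)%C z (df + dg)%C.
Proof.
  intros [H1 H2] [H3 H4].
  split; simpl;
    [eapply is_derive_ext with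
       (fun t => Re (f (set k z t)) + Re (g (set k z t)))
    |eapply is_derive_ext with
       (fun t => Im (f (set k z t)) + Im (g (set k z t)))];
    try reflexivity;
    apply @is_derive_plus; assumption.
Qed.

Ltac derive_values :=
  repeat match goal with
  | H : is_derive ?f ?x ?d |- _ =>
      replace (Derive (fun t : R => f t) x) with d
        by (symmetry; apply is_derive_unique, H); clear H
  end.

(** This is the real part of the complex product rule, and the next lemma its imaginary part. The
    terms are grouped as in [df * g z + f z * dg], so that [is_partial_mult] follows by
    conversion. *)
Lemma is_derive_mult_sub (a b a' b' : R -> R) (x da db da' db' : R) :
  is_derive a x da -> is_derive b x db ->
  is_derive a' x da' -> is_derive b' x db' ->
  is_derive (fun t => a t * a' t - b t * b' t) x
    ((da * a' x - db * b' x) + (a x * da' - b x * db')).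
Proof.
  intros H1 H2 H3 H4.
  auto_derive; [repeat split; eexists; eassumption|].
  derive_values. ring.
Qed.

Lemma is_derive_mult_add (a b a' b' : R -> R) (x da db da' db' : R) :
  is_derive a x da -> is_derive b x db ->
  is_derive a' x da' -> is_derive b' x db' ->
  is_derive (fun t => a t * b' t + b t * a' t) x
    ((da * b' x + db * a' x) + (a x * db' + b x * da')).
Proof.
  intros H1 H2 H3 H4.
  auto_derive; [repeat split; eexists; eassumption|].
  derive_values. ring.
Qed.

(** Both components of a complex inverse have this shape: with [a] and [b] the real and imaginary
    parts, [c] is [a] for the first component and [- b] for the second. *)
Lemma is_derive_div_norm (a b c : R -> R) (x da db dc : R) :
  a x ^ 2 + b x ^ 2 <> 0 ->
  is_derive a x da -> is_derive b x db -> is_derive c x dc ->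
  is_derive (fun t => c t / (a t ^ 2 + b t ^ 2)) x
    ((dc - 2 * c x * (a x * da + b x * db) / (a x ^ 2 + b x ^ 2))
     / (a x ^ 2 + b x ^ 2)).
Proof.
  intros Hn H1 H2 H3.
  auto_derive; [repeat split; try (eexists; eassumption); simpl in *; nra|].
  derive_values. field. simpl in *; nra.
Qed.

Lemma is_partial_mult k (f g : phase -> C) z (df dg : C) :
  is_partial k f z df -> is_partial k g z dg ->
  is_partial k (fun y => f y * g y)%C z (df * g z + f z * dg)%C.
Proof.
  unfold is_partial.
  (* The values at [z] are written at the base point of the coordinate line, which is the form
     produced by the real rules. *)
  replace (f z) with (f (set k z (get k z))) by now rewrite set_get.
  replace (g z) with (g (set k z (get k z))) by now rewrite set_get.
  intros [H1 H2] [H3 H4].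
  split.
  - exact (is_derive_mult_sub _ _ _ _ _ _ _ _ _ H1 H2 H3 H4).
  - exact (is_derive_mult_add _ _ _ _ _ _ _ _ _ H1 H2 H3 H4).
Qed.

Lemma is_partial_inv k (f : phase -> C) z (df : C) :
  f z <> 0 -> is_partial k f z df ->
  is_partial k (fun y => / f y)%C z (- df * (/ f z * / f z))%C.
Proof.
  intros Hf.
  assert (Hn : Re (f z) ^ 2 + Im (f z) ^ 2 <> 0)
    by (intros H; apply Hf, C_ext; simpl; nra).
  revert Hn. clear Hf. unfold is_partial.
  replace (f z) with (f (set k z (get k z))) by now rewrite set_get.
  intros Hn [H1 H2].
  assert (H3 := is_derive_opp _ _ _ H2).
  split.
  - evar_last; [exact (is_derive_div_norm _ _ _ _ _ _ _ Hn H1 H2 H1)|].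
    cbv beta. destruct (f (set k z (get k z))), df; unfold Re, Im in *; simpl in *. field. nra.
  - evar_last; [exact (is_derive_div_norm _ _ _ _ _ _ _ Hn H1 H2 H3)|].
    unfold opp; cbv beta. destruct (f (set k z (get k z))), df; unfold Re, Im in *; simpl in *. field. nra.
Qed.

(** * Smooth functions *)

Lemma locally_on (U : phase -> Prop) (z : phase) : open U -> U z -> locally z U.
Proof. intros HU Hz. now apply HU. Qed.

Lemma continuous_ext_on {V : UniformSpace} (U : phase -> Prop) (f g : phase -> V) z :
  open U -> U z -> (forall z, U z -> f z = g z) -> continuous f z -> continuous g z.
Proof.
  intros HU Hz Hfg. apply continuous_ext_loc.
  apply filter_imp with (2 := locally_on U z HU Hz). intros y Hy. now apply Hfg.
Qed.

Lemma partial_ext_on (U : phase -> Prop) k (f g : phase -> C) z :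
  open U -> U z -> (forall z, U z -> f z = g z) -> partial k f z = partial k g z.
Proof.
  intros HU Hz Hfg.
  apply C_ext; simpl; apply Derive_ext_loc;
    apply filter_imp with (2 := locally_set U k z HU Hz);
    intros t Ht; now rewrite Hfg.
Qed.

Lemma class_C_ext_on n (U : phase -> Prop) (f g : phase -> C) :
  open U -> (forall z, U z -> f z = g z) -> class_C n U f -> class_C n U g.
Proof.
  intros HU. revert f g.
  induction n as [|n IH]; intros f g Hfg [Hc Hd]; split.
  1, 3: intros z Hz; now apply continuous_ext_on with U f; auto.
  - exact I.
  - intros k. destruct (Hd k) as [He Hp]. split.
    + intros z Hz. apply is_partial_ex with (partial k f z).
      apply is_partial_ext with U f; auto. now apply ex_partial_correct, He.
    + apply IH with (partial k f); trivial.
      intros z Hz. now apply partial_ext_on with U.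
Qed.

Lemma class_C_continuous n (U : phase -> Prop) f z :
  class_C n U f -> U z -> continuous f z.
Proof. destruct n; intros [H _]; auto. Qed.

Lemma class_C_ex_partial n (U : phase -> Prop) k f z :
  class_C (S n) U f -> U z -> ex_partial k f z.
Proof. intros [_ H] Hz. now apply (H k). Qed.

Lemma class_C_partial n (U : phase -> Prop) k f :
  class_C (S n) U f -> class_C n U (partial k f).
Proof. intros [_ H]. now apply (H k). Qed.

Lemma class_C_S n (U : phase -> Prop) f : class_C (S n) U f -> class_C n U f.
Proof.
  revert f. induction n as [|n IH]; intros f Hf; split.
  1, 3: intros z; now apply class_C_continuous with (1 := Hf).
  - exact I.
  - intros k; split.
    + intros z. now apply class_C_ex_partial with (1 := Hf).
    + now apply IH, class_C_partial.
Qed.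

(** [partial k f] agrees with an explicit candidate only on [U]; replacing it there by [d k] is what
    makes the inductions on [n] below possible. *)
Lemma class_C_intro n (U : phase -> Prop) f (d : coord -> phase -> C) :
  open U -> (forall z, U z -> continuous f z) ->
  (forall k z, U z -> is_partial k f z (d k z)) ->
  (forall k, class_C n U (d k)) -> class_C (S n) U f.
Proof.
  intros HU Hc Hd Hn. split; trivial. intros k. split.
  - intros z Hz. exact (is_partial_ex _ _ _ _ (Hd k z Hz)).
  - apply class_C_ext_on with (d k); trivial.
    intros z Hz. symmetry. now apply is_partial_unique, Hd.
Qed.

Lemma class_C_partial_correct n (U : phase -> Prop) k f z :
  class_C (S n) U f -> U z -> is_partial k f z (partial k f z).
Proof. intros Hf Hz. now apply ex_partial_correct, class_C_ex_partial with (1 := Hf). Qed.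

Lemma continuous_Cplus {T : UniformSpace} (f g : T -> C) x :
  continuous f x -> continuous g x -> continuous (fun y => f y + g y)%C x.
Proof.
  rewrite !continuous_Re_Im. intros [H1 H2] [H3 H4].
  split; [apply (continuous_plus _ _ _ H1 H3)|apply (continuous_plus _ _ _ H2 H4)].
Qed.

Lemma continuous_Rmult {T : UniformSpace} (f g : T -> R) x :
  continuous f x -> continuous g x -> continuous (fun y => f y * g y) x.
Proof. apply (continuous_mult (K := R_AbsRing)). Qed.

Lemma continuous_Cmult {T : UniformSpace} (f g : T -> C) x :
  continuous f x -> continuous g x -> continuous (fun y => f y * g y)%C x.
Proof.
  rewrite !continuous_Re_Im. intros [H1 H2] [H3 H4]. split.
  - exact (continuous_minus _ _ _ (continuous_Rmult _ _ _ H1 H3)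
      (continuous_Rmult _ _ _ H2 H4)).
  - exact (continuous_plus _ _ _ (continuous_Rmult _ _ _ H1 H4)
      (continuous_Rmult _ _ _ H2 H3)).
Qed.

Lemma continuous_Cinv {T : UniformSpace} (f : T -> C) x :
  f x <> 0 -> continuous f x -> continuous (fun y => / f y)%C x.
Proof.
  intros Hf. rewrite !continuous_Re_Im. intros [H1 H2].
  assert (Hn : continuous (fun y => / (Re (f y) * Re (f y) + Im (f y) * Im (f y))) x).
  { apply (continuous_comp (fun y => Re (f y) * Re (f y) + Im (f y) * Im (f y)) Rinv).
    - exact (continuous_plus _ _ _ (continuous_Rmult _ _ _ H1 H1)
        (continuous_Rmult _ _ _ H2 H2)).
    - apply continuous_Rinv. intros H. apply Hf, C_ext; simpl; nra. }
  split.
  - apply continuous_ext with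
      (fun y => Re (f y) * / (Re (f y) * Re (f y) + Im (f y) * Im (f y))).
    { intros y. unfold Re, Im, Rdiv; simpl. now rewrite !Rmult_1_r. }
    now apply continuous_Rmult.
  - apply continuous_ext with
      (fun y => (- Im (f y)) * / (Re (f y) * Re (f y) + Im (f y) * Im (f y))).
    { intros y. unfold Re, Im, Rdiv; simpl. now rewrite !Rmult_1_r. }
    apply continuous_Rmult; trivial. now apply (continuous_opp (fun y => Im (f y))).
Qed.

Lemma class_C_const n (U : phase -> Prop) (w : C) : open U -> class_C n U (fun _ => w).
Proof.
  intros HU. revert w. induction n as [|n IH]; intros w.
  - split; trivial. intros; apply continuous_const.
  - apply class_C_intro with (fun _ _ => RtoC 0); auto.
    + intros; apply continuous_const.
    + intros; apply is_partial_const.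
Qed.

Lemma class_C_get n (U : phase -> Prop) l :
  open U -> class_C n U (fun y => RtoC (get l y)).
Proof.
  intros HU.
  assert (Hc : forall z, continuous (fun y => RtoC (get l y)) z).
  { intros z. apply continuous_Re_Im. split; simpl;
      [apply continuous_get|apply continuous_const]. }
  destruct n as [|n].
  - split; auto.
  - apply class_C_intro with
      (fun k _ => if coord_eq_dec k l then RtoC 1 else RtoC 0); auto.
    + intros; apply is_partial_get.
    + intros; now apply class_C_const.
Qed.

Lemma class_C_plus n (U : phase -> Prop) (f g : phase -> C) :
  open U -> class_C n U f -> class_C n U g -> class_C n U (fun y => f y + g y)%C.
Proof.
  intros HU. revert f g. induction n as [|n IH]; intros f g Hf Hg.
  - split; trivial. intros z Hz. apply continuous_Cplus;
      [now apply Hf|now apply Hg].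
  - apply class_C_intro with (fun k z => partial k f z + partial k g z)%C; trivial.
    + intros z Hz. apply continuous_Cplus; [now apply Hf|now apply Hg].
    + intros k z Hz. apply is_partial_plus;
        eapply class_C_partial_correct; eassumption.
    + intros k. apply IH; now apply class_C_partial.
Qed.

Lemma class_C_mult n (U : phase -> Prop) (f g : phase -> C) :
  open U -> class_C n U f -> class_C n U g -> class_C n U (fun y => f y * g y)%C.
Proof.
  intros HU. revert f g. induction n as [|n IH]; intros f g Hf Hg.
  - split; trivial. intros z Hz. apply continuous_Cmult;
      [now apply Hf|now apply Hg].
  - apply class_C_intro with
      (fun k z => partial k f z * g z + f z * partial k g z)%C; trivial.
    + intros z Hz. apply continuous_Cmult; [now apply Hf|now apply Hg].
    + intros k z Hz. apply is_partial_mult;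
        eapply class_C_partial_correct; eassumption.
    (* Each Leibniz term pairs a derivative of class [n] with an undifferentiated factor of class
       [S n], which is lowered by [class_C_S]. *)
    + intros k. apply class_C_plus; trivial; apply IH;
        solve [now apply class_C_partial | now apply class_C_S].
Qed.

Lemma class_C_inv n (U : phase -> Prop) (f : phase -> C) :
  open U -> (forall z, U z -> f z <> 0) ->
  class_C n U f -> class_C n U (fun y => / f y)%C.
Proof.
  intros HU H0. induction n as [|n IH]; intros Hf.
  - split; trivial. intros z Hz. apply continuous_Cinv; [now apply H0|now apply Hf].
  (* The sign is written as a constant factor, so that closure under constants and products covers
     the whole derivative. *)
  - apply class_C_intro with
      (fun k z => - RtoC 1 * partial k f z * (/ f z * / f z))%C; trivial.
    + intros z Hz. apply continuous_Cinv; [now apply H0|now apply Hf].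
    + intros k z Hz.
      replace (- RtoC 1 * partial k f z)%C with (- partial k f z)%C by ring.
      apply is_partial_inv; auto. eapply class_C_partial_correct; eassumption.
    + assert (class_C n U (fun y => / f y)%C) by now apply IH, class_C_S.
      intros k. repeat apply class_C_mult; trivial.
      * now apply class_C_const.
      * now apply class_C_partial.
Qed.

Lemma smooth_ext_on (U : phase -> Prop) (f g : phase -> C) :
  open U -> (forall z, U z -> f z = g z) -> smooth U f -> smooth U g.
Proof. intros HU H Hf n. now apply class_C_ext_on with f. Qed.

Lemma smooth_const (U : phase -> Prop) (w : C) : open U -> smooth U (fun _ => w).
Proof. intros HU n. now apply class_C_const. Qed.

Lemma smooth_get (U : phase -> Prop) l : open U -> smooth U (fun y => RtoC (get l y)).
Proof. intros HU n. now apply class_C_get. Qed.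

Lemma smooth_plus (U : phase -> Prop) (f g : phase -> C) :
  open U -> smooth U f -> smooth U g -> smooth U (fun y => f y + g y)%C.
Proof. intros HU Hf Hg n. now apply class_C_plus. Qed.

Lemma smooth_mult (U : phase -> Prop) (f g : phase -> C) :
  open U -> smooth U f -> smooth U g -> smooth U (fun y => f y * g y)%C.
Proof. intros HU Hf Hg n. now apply class_C_mult. Qed.

Lemma smooth_inv (U : phase -> Prop) (f : phase -> C) :
  open U -> (forall z, U z -> f z <> 0) ->
  smooth U f -> smooth U (fun y => / f y)%C.
Proof. intros HU H0 Hf n. now apply class_C_inv. Qed.

Lemma smooth_partial (U : phase -> Prop) k (f : phase -> C) :
  smooth U f -> smooth U (partial k f).
Proof. intros Hf n. exact (class_C_partial n U k f (Hf (S n))). Qed.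

Lemma smooth_opp (U : phase -> Prop) (f : phase -> C) :
  open U -> smooth U f -> smooth U (fun y => - f y)%C.
Proof.
  intros HU Hf. apply smooth_ext_on with (fun y => - RtoC 1 * f y)%C; trivial.
  - intros; ring.
  - apply smooth_mult; trivial. now apply smooth_const.
Qed.

Lemma smooth_minus (U : phase -> Prop) (f g : phase -> C) :
  open U -> smooth U f -> smooth U g -> smooth U (fun y => f y - g y)%C.
Proof. intros HU Hf Hg. apply smooth_plus; trivial. now apply smooth_opp. Qed.

Lemma smooth_pow (U : phase -> Prop) (f : phase -> C) n :
  open U -> smooth U f -> smooth U (fun y => f y ^ n)%C.
Proof.
  intros HU Hf. induction n as [|n IH];
    [exact (smooth_const U 1 HU)|exact (smooth_mult U f _ HU Hf IH)].
Qed.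

Lemma smooth_partial_correct (U : phase -> Prop) k f z :
  smooth U f -> U z -> is_partial k f z (partial k f z).
Proof. intros Hf. apply class_C_partial_correct with (n := O). apply Hf. Qed.

Lemma partial_plus (U : phase -> Prop) k (f g : phase -> C) z :
  smooth U f -> smooth U g -> U z ->
  partial k (fun y => f y + g y)%C z = (partial k f z + partial k g z)%C.
Proof.
  intros Hf Hg Hz. apply is_partial_unique, is_partial_plus;
    now apply smooth_partial_correct with U.
Qed.

Lemma partial_mult (U : phase -> Prop) k (f g : phase -> C) z :
  smooth U f -> smooth U g -> U z ->
  partial k (fun y => f y * g y)%C z = (partial k f z * g z + f z * partial k g z)%C.
Proof.
  intros Hf Hg Hz. apply is_partial_unique, is_partial_mult;
    now apply smooth_partial_correct with U.
Qed.

Lemma partial_const k (w : C) z : partial k (fun _ => w) z = 0.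
Proof. apply is_partial_unique, is_partial_const. Qed.

(** * Symmetry of second partial derivatives *)

Lemma rpartial_comm (U : phase -> Prop) k l (f : phase -> R) z :
  open U -> k <> l -> U z ->
  (forall k y, U y -> ex_rpartial k f y) ->
  (forall k l y, U y -> ex_rpartial k (rpartial l f) y) ->
  (forall k l y, U y -> continuous (rpartial k (rpartial l f)) y) ->
  rpartial k (rpartial l f) z = rpartial l (rpartial k f) z.
Proof.
  intros HU Hkl Hz H1 H2 Hc.
  assert (Hlk : l <> k) by auto.
  (* The two-dimensional slice through [z] along the coordinates [k] and [l]. Iterated derivatives
     of [f] along it are iterated partial derivatives at the points of the slice, which reduces the
     claim to Schwarz's theorem in the plane. *)
  set (w := fun s t => set l (set k z s) t).
  assert (Hw : forall s t, w s t = set k (set l z t) s)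
    by (intros; now apply set_set_comm).
  assert (Gk : forall s t, get k (w s t) = s)
    by (intros; rewrite Hw; apply get_set).
  assert (Gl : forall s t, get l (w s t) = t) by (intros; apply get_set).
  assert (Sk : forall s t s', set k (w s t) s' = w s' t)
    by (intros; rewrite !Hw; apply set_set).
  assert (Sl : forall s t t', set l (w s t) t' = w s t')
    by (intros; apply set_set).
  assert (Dk : forall (h : phase -> R) s t,
    Derive (fun s' => h (w s' t)) s = rpartial k h (w s t)).
  { intros h s t. unfold rpartial. rewrite Gk.
    apply Derive_ext. intros; now rewrite Sk. }
  assert (Dl : forall (h : phase -> R) s t,
    Derive (fun t' => h (w s t')) t = rpartial l h (w s t)).
  { intros h s t. unfold rpartial. rewrite Gl.
    apply Derive_ext. intros; now rewrite Sl. }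
  assert (Wz : w (get k z) (get l z) = z) by (unfold w; now rewrite !set_get).
  assert (Wc : forall s t, continuous (fun st : R * R => w (fst st) (snd st)) (s, t)).
  { intros s t. unfold w.
    apply (continuous_comp_2 (fun st : R * R => set k z (fst st)) snd (set l)).
    - apply (continuous_comp_2 (fun _ : R * R => z) fst (set k)).
      + apply continuous_const.
      + apply continuous_fst.
      + apply (continuous_set k (z, s)).
    - apply continuous_snd.
    - apply (continuous_set l (set k z s, t)). }
  assert (C2 : forall h : phase -> R, continuous h z ->
    continuity_2d_pt (fun s t => h (w s t)) (get k z) (get l z)).
  { intros h Hh. apply continuity_2d_pt_filterlim.
    apply (continuous_comp (fun st : R * R => w (fst st) (snd st)) h).
    - apply Wc.
    - simpl. now rewrite Wz. }
  assert (E1 : forall s t, Derive (fun s' => Derive (fun t' => f (w s' t')) t) s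
    = rpartial k (rpartial l f) (w s t)).
  { intros s t. rewrite <- Dk. apply Derive_ext. intros; apply Dl. }
  assert (E2 : forall s t, Derive (fun t' => Derive (fun s' => f (w s' t')) s) t
    = rpartial l (rpartial k f) (w s t)).
  { intros s t. rewrite <- Dl. apply Derive_ext. intros; apply Dk. }
  rewrite <- Wz, <- E1, <- E2. apply Schwarz.
  - assert (HL : locally (get k z, get l z) (fun st : R * R => U (w (fst st) (snd st)))).
    { apply (Wc (get k z) (get l z)). simpl. rewrite Wz. now apply HU. }
    apply locally_2d_locally. apply filter_imp with (2 := HL).
    intros [s t] Hst. simpl in *. repeat split.
    + destruct (H1 k _ Hst) as [d Hd]. exists d. rewrite Gk in Hd.
      apply is_derive_ext with (2 := Hd). intros; now rewrite Sk.
    + destruct (H1 l _ Hst) as [d Hd]. exists d. rewrite Gl in Hd.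
      apply is_derive_ext with (2 := Hd). intros; now rewrite Sl.
    + destruct (H2 k l _ Hst) as [d Hd]. exists d. rewrite Gk in Hd.
      apply is_derive_ext with (2 := Hd). intros; rewrite Sk. now rewrite <- Dl.
    + destruct (H2 l k _ Hst) as [d Hd]. exists d. rewrite Gl in Hd.
      apply is_derive_ext with (2 := Hd). intros; rewrite Sl. now rewrite <- Dk.
  - apply continuity_2d_pt_ext with (2 := C2 _ (Hc k l z Hz)).
    intros; now rewrite E1.
  - apply continuity_2d_pt_ext with (2 := C2 _ (Hc l k z Hz)).
    intros; now rewrite E2.
Qed.

Lemma partial_comm (U : phase -> Prop) k l (f : phase -> C) z :
  open U -> smooth U f -> U z ->
  partial k (partial l f) z = partial l (partial k f) z.
Proof.
  intros HU Hf Hz. destruct (coord_eq_dec k l) as [->|Hkl]; trivial.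
  apply C_ext; simpl; apply rpartial_comm with U; trivial; intros.
  all: first [ apply (class_C_ex_partial 0 U k0 f y (Hf 1%nat)); assumption
    | apply (class_C_ex_partial 0 U k0 (partial l0 f) y (smooth_partial U l0 f Hf 1%nat));
      assumption | idtac].
  all: pose proof (class_C_continuous 0 U _ y
      (smooth_partial U k0 _ (smooth_partial U l0 f Hf) 0%nat) ltac:(assumption)) as Hc;
    rewrite continuous_Re_Im in Hc; apply Hc.
Qed.

Ltac smoothness :=
  repeat match goal with
  | |- open _ => assumption
  | H : smooth ?U ?f |- smooth ?U ?f => exact H
  | H : forall i, smooth ?U (@?f i) |- smooth ?U _ => solve [apply H]
  | |- smooth ?U (fun _ => ?w) => apply (smooth_const U w)
  | |- smooth ?U (fun y => (@?f y + @?g y)%C) => apply (smooth_plus U f g)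
  | |- smooth ?U (fun y => (@?f y - @?g y)%C) => apply (smooth_minus U f g)
  | |- smooth ?U (fun y => (@?f y * @?g y)%C) => apply (smooth_mult U f g)
  | |- smooth ?U (fun y => (- @?f y)%C) => apply (smooth_opp U f)
  | |- smooth ?U (fun y => (@?f y ^ ?n)%C) => apply (smooth_pow U f n)
  | |- smooth ?U (fun y => ?f y) => change (smooth U f)
  end.

(** * Poisson brackets from commuting derivations *)

(** Locality is an axiom because functions on [U] are represented by total ones. Coordinate
    derivatives and Hamiltonian operators are both instances, so one differential calculus serves
    for all of them. *)
Record derivation (U : phase -> Prop) (D : (phase -> C) -> phase -> C) : Prop := {
  der_smooth : forall f, smooth U f -> smooth U (D f);
  der_local : forall f g z, smooth U f -> smooth U g ->
    (forall z, U z -> f z = g z) -> U z -> D f z = D g z;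
  der_const : forall (w : C) z, U z -> D (fun _ => w) z = 0;
  der_plus : forall f g z, smooth U f -> smooth U g -> U z ->
    D (fun y => f y + g y)%C z = (D f z + D g z)%C;
  der_mult : forall f g z, smooth U f -> smooth U g -> U z ->
    D (fun y => f y * g y)%C z = (D f z * g z + f z * D g z)%C
}.

Lemma der_opp U D f z : open U -> derivation U D -> smooth U f -> U z ->
  D (fun y => - f y)%C z = (- D f z)%C.
Proof.
  intros HU HD Hf Hz.
  rewrite (der_local U D HD _ (fun y => (- RtoC 1)%C * f y)%C);
    try solve [smoothness | assumption].
  - rewrite (der_mult U D HD (fun _ => (- RtoC 1)%C)); smoothness; trivial.
    rewrite (der_const U D HD); trivial. ring.
  - intros y _. ring.
Qed.

Lemma der_minus U D f g z :
  open U -> derivation U D -> smooth U f -> smooth U g -> U z ->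
  D (fun y => f y - g y)%C z = (D f z - D g z)%C.
Proof.
  intros HU HD Hf Hg Hz. unfold Cminus.
  rewrite (der_plus U D HD f (fun y => - g y)%C); smoothness; trivial.
  now rewrite (der_opp U).
Qed.

Lemma derivation_partial U k : open U -> derivation U (partial k).
Proof.
  intros HU. split; intros.
  - now apply smooth_partial.
  - now apply partial_ext_on with U.
  - apply partial_const.
  - now apply partial_plus with U.
  - now apply partial_mult with U.
Qed.

(** Commuting derivations, indexed like the coordinate fields that they generalize. *)
Record frame (U : phase -> Prop) (D : coord -> (phase -> C) -> phase -> C) : Prop := {
  frame_der : forall k, derivation U (D k);
  frame_comm : forall k l f z, smooth U f -> U z ->
    D k (D l f) z = D l (D k f) z
}.

Definition frame_bracket (D : coord -> (phase -> C) -> phase -> C)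
    (mu : idx -> phase -> C) : bracket := fun f g z =>
  (mu I1 z * (D (Pos I1) f z * D (Mom I1) g z - D (Mom I1) f z * D (Pos I1) g z)
   + mu I2 z * (D (Pos I2) f z * D (Mom I2) g z - D (Mom I2) f z * D (Pos I2) g z))%C.

(* The condition says that [mu i] depends only on the i-th pair of coordinates
   of the frame. *)
Definition separated (U : phase -> Prop) (D : coord -> (phase -> C) -> phase -> C)
    (mu : idx -> phase -> C) : Prop :=
  forall i j z, U z -> i <> j -> D (Pos j) (mu i) z = 0 /\ D (Mom j) (mu i) z = 0.

Lemma smooth_frame_bracket U D mu f g :
  open U -> frame U D -> (forall i, smooth U (mu i)) ->
  smooth U f -> smooth U g -> smooth U (frame_bracket D mu f g).
Proof.
  intros HU HD Hmu Hf Hg.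
  assert (HDs : forall h, smooth U h -> forall k, smooth U (D k h))
    by (intros h Hh k; now apply (der_smooth U (D k)), Hh; apply HD).
  pose proof (HDs f Hf). pose proof (HDs g Hg).
  unfold frame_bracket. smoothness.
Qed.

(** With the outer derivation expanded in this form, the Jacobi identity becomes polynomial in first
    and second derivatives. *)
Lemma der_frame_bracket U D mu d f g z :
  open U -> frame U D -> derivation U d -> (forall i, smooth U (mu i)) ->
  smooth U f -> smooth U g -> U z ->
  d (frame_bracket D mu f g) z =
  (d (mu I1) z * (D (Pos I1) f z * D (Mom I1) g z - D (Mom I1) f z * D (Pos I1) g z)
   + mu I1 z * ((d (D (Pos I1) f) z * D (Mom I1) g z + D (Pos I1) f z * d (D (Mom I1) g) z)
     - (d (D (Mom I1) f) z * D (Pos I1) g z + D (Mom I1) f z * d (D (Pos I1) g) z))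
   + (d (mu I2) z * (D (Pos I2) f z * D (Mom I2) g z - D (Mom I2) f z * D (Pos I2) g z)
   + mu I2 z * ((d (D (Pos I2) f) z * D (Mom I2) g z + D (Pos I2) f z * d (D (Mom I2) g) z)
     - (d (D (Mom I2) f) z * D (Pos I2) g z + D (Mom I2) f z * d (D (Pos I2) g) z))))%C.
Proof.
  intros HU HD Hd Hmu Hf Hg Hz.
  assert (HDs : forall h, smooth U h -> forall k, smooth U (D k h))
    by (intros h Hh k; now apply (der_smooth U (D k)), Hh; apply HD).
  pose proof (HDs f Hf) as Hf'. pose proof (HDs g Hg) as Hg'.
  set (t := fun i y => (D (Pos i) f y * D (Mom i) g y
    - D (Mom i) f y * D (Pos i) g y)%C).
  assert (Ht : forall i, smooth U (t i)) by (intros i; unfold t; smoothness).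
  change (frame_bracket D mu f g) with (fun y => mu I1 y * t I1 y + mu I2 y * t I2 y)%C.
  assert (Hdt : forall i, d (t i) z =
    ((d (D (Pos i) f) z * D (Mom i) g z + D (Pos i) f z * d (D (Mom i) g) z)
     - (d (D (Mom i) f) z * D (Pos i) g z + D (Mom i) f z * d (D (Pos i) g) z))%C).
  { intros i. unfold t.
    rewrite (der_minus U d (fun y => D (Pos i) f y * D (Mom i) g y)%C
      (fun y => D (Mom i) f y * D (Pos i) g y)%C); smoothness; trivial.
    now rewrite !(der_mult U d Hd). }
  rewrite (der_plus U d Hd (fun y => mu I1 y * t I1 y)%C (fun y => mu I2 y * t I2 y)%C);
    smoothness; trivial.
  rewrite !(der_mult U d Hd); trivial. rewrite !Hdt. unfold t. ring.
Qed.

(** Only the Jacobi identity uses more than the derivation rules. Commutation makes the second-order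
    terms cancel in the cyclic sum. The derivatives of [mu i] that survive are along the [i]-th
    pair; they cancel as for a rescaled bracket in two dimensions. *)
Lemma is_poisson_frame_bracket U D mu :
  open U -> frame U D -> (forall i, smooth U (mu i)) -> separated U D mu ->
  is_poisson_bracket U (frame_bracket D mu).
Proof.
  intros HU HD Hmu Hsep.
  assert (HDk := frame_der _ _ HD).
  split.
  - intros; now apply smooth_frame_bracket.
  - intros f f' g g' Hf Hf' Hg Hg' Ef Eg z Hz. unfold frame_bracket.
    assert (E1 : forall k, D k f z = D k f' z)
      by (intros k; now apply (der_local U _ (HDk k))).
    assert (E2 : forall k, D k g z = D k g' z)
      by (intros k; now apply (der_local U _ (HDk k))).
    now rewrite !E1, !E2.
  - intros s t f g h Hf Hg Hh z Hz. unfold frame_bracket.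
    assert (E : forall k, D k (fun y => s * f y + t * g y)%C z
      = (s * D k f z + t * D k g z)%C).
    { intros k. rewrite (der_plus U _ (HDk k) (fun y => s * f y)%C (fun y => t * g y)%C);
        smoothness; trivial.
      rewrite (der_mult U _ (HDk k) (fun _ => s)), (der_mult U _ (HDk k) (fun _ => t));
        smoothness; trivial.
      rewrite !(der_const U _ (HDk k)); trivial. ring. }
    rewrite !E. ring.
  - intros f g Hf Hg z Hz. unfold frame_bracket. ring.
  - intros f g h Hf Hg Hh z Hz. unfold frame_bracket.
    assert (E : forall k, D k (fun y => f y * g y)%C z
      = (D k f z * g z + f z * D k g z)%C)
      by (intros k; now apply (der_mult U _ (HDk k))).
    rewrite !E. ring.
  - intros f g h Hf Hg Hh z Hz.
    (* Only the three outer brackets are opened; the inner ones are differentiated as wholes. *)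
    unfold frame_bracket at 1 3 5.
    rewrite !(der_frame_bracket U D mu _ _ _ z HU HD (HDk _) Hmu) by assumption.
    destruct (Hsep I1 I2 z Hz ltac:(discriminate)) as [-> ->].
    destruct (Hsep I2 I1 z Hz ltac:(discriminate)) as [-> ->].
    (* The second derivatives are brought to one common order, so that [ring] sees equal atoms. *)
    rewrite !(frame_comm U D HD (Mom I1) (Pos I1) _ z),
      !(frame_comm U D HD (Mom I1) (Pos I2) _ z),
      !(frame_comm U D HD (Mom I2) (Pos I1) _ z),
      !(frame_comm U D HD (Mom I2) (Pos I2) _ z),
      !(frame_comm U D HD (Pos I2) (Pos I1) _ z),
      !(frame_comm U D HD (Mom I2) (Mom I1) _ z) by assumption.
    ring.
Qed.

(** Agreement on [U] suffices even for the nested brackets of the Jacobi identity, since locality of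
    [br] allows its inner argument to be replaced by one equal to it on [U]. *)
Lemma is_poisson_bracket_ext U (br br' : bracket) :
  open U ->
  (forall f g z, smooth U f -> smooth U g -> U z -> br f g z = br' f g z) ->
  is_poisson_bracket U br -> is_poisson_bracket U br'.
Proof.
  intros HU E HP.
  assert (Hs : forall f g, smooth U f -> smooth U g -> smooth U (br' f g)).
  { intros f g Hf Hg. apply smooth_ext_on with (br f g); auto.
    now apply (pb_smooth U br HP). }
  split; trivial.
  - intros f f' g g' Hf Hf' Hg Hg' Ef Eg z Hz.
    rewrite <- !E by assumption. now apply (pb_local U br HP).
  - intros s t f g h Hf Hg Hh z Hz.
    rewrite <- !E by (smoothness; assumption). now apply (pb_linear U br HP).
  - intros f g Hf Hg z Hz.
    rewrite <- !E by assumption. now apply (pb_skew U br HP).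
  - intros f g h Hf Hg Hh z Hz.
    rewrite <- !E by (smoothness; assumption). now apply (pb_leibniz U br HP).
  - intros f g h Hf Hg Hh z Hz.
    rewrite <- (pb_jacobi U br HP f g h Hf Hg Hh z Hz).
    assert (E2 : forall f g h, smooth U f -> smooth U g -> smooth U h ->
      br' f (br' g h) z = br f (br g h) z).
    { intros f1 g1 h1 Hf1 Hg1 Hh1. rewrite <- E by auto.
      apply (pb_local U br HP); auto. now apply (pb_smooth U br HP).
      intros; symmetry; now apply E. }
    now rewrite !E2.
Qed.

(** * The canonical bracket as a frame bracket *)

Lemma frame_partial U : open U -> frame U partial.
Proof.
  intros HU. split.
  - intros k; now apply derivation_partial.
  - intros; now apply partial_comm with U.
Qed.

Lemma canonical_frame_bracket f g z :
  canonical f g z = frame_bracket partial (fun _ _ => RtoC 1) f g z.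
Proof. unfold canonical, frame_bracket. ring. Qed.

Lemma is_poisson_canonical U : open U -> is_poisson_bracket U canonical.
Proof.
  intros HU.
  apply is_poisson_bracket_ext with (frame_bracket partial (fun _ _ => RtoC 1)); trivial.
  - intros; symmetry; apply canonical_frame_bracket.
  - apply is_poisson_frame_bracket; trivial.
    + now apply frame_partial.
    + intros; now apply smooth_const.
    + intros i j z Hz _. now rewrite !partial_const.
Qed.

Lemma canonical_skew f g z : canonical f g z = (- canonical g f z)%C.
Proof. unfold canonical. ring. Qed.

Lemma derivation_canonical_l U h :
  open U -> smooth U h -> derivation U (fun f => canonical f h).
Proof.
  intros HU Hh.
  assert (HP := is_poisson_canonical U HU).
  split.
  - intros. now apply (pb_smooth U _ HP).
  - intros. now apply (pb_local U _ HP).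
  - intros. unfold canonical. rewrite !partial_const. ring.
  - intros. unfold canonical. rewrite !(partial_plus U) by assumption. ring.
  - intros. rewrite (pb_leibniz U _ HP) by assumption. ring.
Qed.

Lemma derivation_canonical_r U h :
  open U -> smooth U h -> derivation U (canonical h).
Proof.
  intros HU Hh.
  assert (HP := is_poisson_canonical U HU).
  split.
  - intros. now apply (pb_smooth U _ HP).
  - intros. now apply (pb_local U _ HP).
  - intros. unfold canonical. rewrite !partial_const. ring.
  - intros. unfold canonical. rewrite !(partial_plus U) by assumption. ring.
  - intros. unfold canonical. rewrite !(partial_mult U) by assumption. ring.
Qed.

(** * Frames defined by canonical pairs *)

Definition canonical_pairs (U : phase -> Prop) (x q : idx -> phase -> C) : Prop :=
  (forall i, smooth U (x i)) /\ (forall i, smooth U (q i)) /\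
  forall i j z, U z -> canonical (x i) (q j) z = delta i j /\
    canonical (x i) (x j) z = 0 /\ canonical (q i) (q j) z = 0.

(** In a chart with coordinates [x i], [q i] these fields would be the derivatives along [x i] and
    along [q i]. Their definition through the bracket avoids inverting the change of variables. *)
Definition pair_frame (x q : idx -> phase -> C) (k : coord) : vector_field :=
  match k with
  | Pos i => fun f => canonical f (q i)
  | Mom i => canonical (x i)
  end.

(** By the Jacobi identity the commutator of the operators [{g, .}] and [{h, .}] is [{{g, h}, .}],
    which vanishes when [{g, h}] is constant. *)
Lemma canonical_field_comm U g h f z :
  open U -> smooth U f -> smooth U g -> smooth U h -> U z ->
  (exists w : C, forall z, U z -> canonical g h z = w) ->
  canonical g (canonical h f) z = canonical h (canonical g f) z.
Proof.
  intros HU Hf Hg Hh Hz [w Hw].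
  assert (HP := is_poisson_canonical U HU).
  assert (HJ := pb_jacobi U _ HP f g h Hf Hg Hh z Hz).
  assert (E : canonical f (canonical g h) z = 0).
  { rewrite (der_local U _ (derivation_canonical_r U f HU Hf) _ (fun _ => w));
      smoothness; trivial.
    - apply (der_const U _ (derivation_canonical_r U f HU Hf)); trivial.
    - now apply (pb_smooth U _ HP). }
  rewrite E in HJ.
  assert (E2 : canonical h (canonical f g) z = (- canonical h (canonical g f) z)%C).
  { rewrite (der_local U _ (derivation_canonical_r U h HU Hh) _
      (fun y => - canonical g f y)%C); trivial.
    - apply (der_opp U); trivial; [now apply derivation_canonical_r|].
      now apply (pb_smooth U _ HP).
    - now apply (pb_smooth U _ HP).
    - apply smooth_opp; trivial. now apply (pb_smooth U _ HP).
    - intros; apply canonical_skew. }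
  rewrite E2 in HJ.
  transitivity ((0 + canonical g (canonical h f) z + - canonical h (canonical g f) z)
    + canonical h (canonical g f) z)%C; [ring|]. rewrite HJ. ring.
Qed.

(** All brackets between members of the pairs are constant, so the previous lemma applies to any two
    fields; [Ho], [Hn] and [Hnn] only account for the signs caused by the fields [{., q i}]. *)
Lemma frame_pair_frame U x q :
  open U -> canonical_pairs U x q -> frame U (pair_frame x q).
Proof.
  intros HU [Hx [Hq Hxq]]. split.
  - intros [i|i]; simpl; [apply derivation_canonical_l|apply derivation_canonical_r]; auto.
  - assert (HP := is_poisson_canonical U HU).
    assert (Ho : forall g h z, smooth U g -> smooth U h -> U z ->
      canonical g (fun y => - h y)%C z = (- canonical g h z)%C).
    { intros g h z Hg Hh Hz. apply (der_opp U); trivial.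
      now apply derivation_canonical_r. }
    assert (Hn : forall g h f z, smooth U g -> smooth U h -> smooth U f -> U z ->
      canonical g (canonical f h) z = (- canonical g (canonical h f) z)%C).
    { intros g h f z Hg Hh Hf Hz. rewrite <- Ho; trivial.
      - apply (der_local U _ (derivation_canonical_r U g HU Hg)); trivial.
        + now apply (pb_smooth U _ HP).
        + apply smooth_opp; trivial. now apply (pb_smooth U _ HP).
        + intros; apply canonical_skew.
      - now apply (pb_smooth U _ HP). }
    assert (Hnn : forall g h f z, smooth U g -> smooth U h -> smooth U f -> U z ->
      canonical (canonical f h) g z = canonical g (canonical h f) z).
    { intros g h f z Hg Hh Hf Hz. rewrite canonical_skew, Hn by assumption. ring. }
    assert (Hqq : forall i j f z, smooth U f -> U z ->
      canonical (q i) (canonical (q j) f) z = canonical (q j) (canonical (q i) f) z).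
    { intros. apply (canonical_field_comm U); trivial. exists 0.
      intros y Hy. now destruct (Hxq i j y Hy) as [_ [_ E]]. }
    assert (Hxx : forall i j f z, smooth U f -> U z ->
      canonical (x i) (canonical (x j) f) z = canonical (x j) (canonical (x i) f) z).
    { intros. apply (canonical_field_comm U); trivial. exists 0.
      intros y Hy. now destruct (Hxq i j y Hy) as [_ [E _]]. }
    assert (Hx_q : forall i j f z, smooth U f -> U z ->
      canonical (x i) (canonical (q j) f) z = canonical (q j) (canonical (x i) f) z).
    { intros. apply (canonical_field_comm U); trivial.
      exists (delta i j). intros y Hy. now destruct (Hxq i j y Hy) as [E _]. }
    intros [i|i] [j|j] f z Hf Hz; simpl.
    + rewrite !Hnn by auto. auto.
    + rewrite (Hn (x j) (q i)), (canonical_skew (canonical _ _)), Hx_q by auto. reflexivity.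
    + rewrite (Hn (x i) (q j)), (canonical_skew (canonical _ _)), Hx_q by auto. reflexivity.
    + auto.
Qed.

(* Six vectors of a four-dimensional symplectic space have a singular Gram
   matrix; this is the vanishing of the Pfaffian of that matrix. *)
Lemma pfaffian_canonical (f1 f2 f3 f4 f5 f6 : phase -> C) z :
  (canonical f1 f2 z * (canonical f3 f4 z * canonical f5 f6 z
     - canonical f3 f5 z * canonical f4 f6 z + canonical f3 f6 z * canonical f4 f5 z)
   - canonical f1 f3 z * (canonical f2 f4 z * canonical f5 f6 z
     - canonical f2 f5 z * canonical f4 f6 z + canonical f2 f6 z * canonical f4 f5 z)
   + canonical f1 f4 z * (canonical f2 f3 z * canonical f5 f6 z
     - canonical f2 f5 z * canonical f3 f6 z + canonical f2 f6 z * canonical f3 f5 z)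
   - canonical f1 f5 z * (canonical f2 f3 z * canonical f4 f6 z
     - canonical f2 f4 z * canonical f3 f6 z + canonical f2 f6 z * canonical f3 f4 z)
   + canonical f1 f6 z * (canonical f2 f3 z * canonical f4 f5 z
     - canonical f2 f4 z * canonical f3 f5 z + canonical f2 f5 z * canonical f3 f4 z))%C
  = 0.
Proof. unfold canonical. ring. Qed.

(** The Pfaffian identity for the two pairs together with [f] and [g] is linear in [{f, g}] with
    coefficient one, and can be solved for it. This puts the canonical bracket in the same frame as
    the second bracket, with weights one. *)
Lemma canonical_pair_frame U x q f g z :
  canonical_pairs U x q -> U z ->
  canonical f g z = frame_bracket (pair_frame x q) (fun _ _ => RtoC 1) f g z.
Proof.
  intros [Hx [Hq Hxq]] Hz. unfold frame_bracket, pair_frame.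
  pose proof (pfaffian_canonical (x I1) (q I1) (x I2) (q I2) f g z) as H.
  destruct (Hxq I1 I1 z Hz) as [E11 _], (Hxq I2 I2 z Hz) as [E22 _],
    (Hxq I1 I2 z Hz) as [E12 [X12 Q12]], (Hxq I2 I1 z Hz) as [E21 _].
  rewrite (canonical_skew (q I1) (x I2)), E11, E22, E12, E21, X12, Q12 in H.
  simpl in H.
  rewrite (canonical_skew (q I1) f), (canonical_skew (q I1) g),
    (canonical_skew (q I2) f), (canonical_skew (q I2) g) in H.
  match type of H with ?l = _ => transitivity (canonical f g z - l)%C end;
    [rewrite H; ring|ring].
Qed.

(** * The rational functions of the canonical coordinates *)

(** At zero both inverses take the default value zero, so [push_RtoC] moves quotients into [C]
    without side conditions. *)
Lemma RtoC_inv_total (x : R) : RtoC (/ x) = (/ RtoC x)%C.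
Proof.
  destruct (Req_dec x 0) as [->|Hx]; [|now apply RtoC_inv].
  rewrite Rinv_0. apply C_ext; simpl; unfold Rdiv; rewrite ?Ropp_0; ring.
Qed.

Lemma RtoC_div_total (x y : R) : RtoC (x / y) = (RtoC x / RtoC y)%C.
Proof. unfold Rdiv, Cdiv. now rewrite RtoC_mult, RtoC_inv_total. Qed.

Ltac push_RtoC :=
  rewrite ?RtoC_plus, ?RtoC_minus, ?RtoC_div_total, ?RtoC_mult, ?RtoC_pow;
  repeat (progress
    rewrite ?RtoC_plus, ?RtoC_minus, ?RtoC_opp, ?RtoC_div_total, ?RtoC_mult,
      ?RtoC_pow).

Lemma RtoC_neq_0 (x : R) : x <> 0 -> RtoC x <> 0.
Proof. intros Hx H. apply Hx. now apply RtoC_inj. Qed.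

Lemma class_C_subset n (U V : phase -> Prop) f :
  (forall z, V z -> U z) -> class_C n U f -> class_C n V f.
Proof.
  intros HVU. revert f. induction n as [|n IH]; intros f [Hc Hd]; split; auto.
  intros k. destruct (Hd k). split; auto.
Qed.

Lemma smooth_subset (U V : phase -> Prop) f :
  (forall z, V z -> U z) -> smooth U f -> smooth V f.
Proof. intros HVU Hf n. now apply class_C_subset with U. Qed.

Lemma open_regular : open regular.
Proof.
  assert (Hg : forall l (z : phase), filterlim (get l) (locally z) (locally (get l z)))
    by (intros; apply continuous_get).
  unfold regular. apply open_and; [|apply open_and].
  - apply (open_comp (fun z => (get (Pos I1) z, get (Pos I2) z))
      (fun w : R * R => fst w <> snd w)).
    + intros z _. apply (continuous_pair (get (Pos I1)) (get (Pos I2)));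
        apply continuous_get.
    + apply open_ext with (fun w : R * R => fst w - snd w <> 0); [intros; lra|].
      apply (open_comp (fun w : R * R => fst w - snd w) (fun x => x <> 0));
        [|apply open_neq].
      intros [s t] _. apply (continuous_minus (fun w : R * R => fst w) snd);
        [apply continuous_fst|apply continuous_snd].
  - apply (open_comp (get (Pos I1)) (fun x => x <> 0)); [auto|apply open_neq].
  - apply (open_comp (get (Pos I2)) (fun x => x <> 0)); [auto|apply open_neq].
Qed.

(** Apply the derivation to [f * / f], which equals one on [U]; the rule thus holds for every
    derivation. *)
Lemma der_inv U D (f : phase -> C) z :
  open U -> derivation U D -> smooth U f -> (forall z, U z -> f z <> 0) -> U z ->
  D (fun y => / f y)%C z = (- D f z * (/ f z * / f z))%C.
Proof.
  intros HU HD Hf H0 Hz.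
  assert (Hi : smooth U (fun y => / f y)%C) by now apply smooth_inv.
  pose proof (der_mult U D HD f _ z Hf Hi Hz) as H.
  rewrite (der_local U D HD _ (fun _ => RtoC 1)), (der_const U D HD) in H; trivial.
  - assert (f z <> 0) by auto.
    transitivity (/ f z * (f z * D (fun y => / f y)%C z))%C; [now field|].
    transitivity (/ f z * ((D f z * / f z + f z * D (fun y => / f y)%C z)
      - D f z * / f z))%C; [now field|]. rewrite <- H. now field.
  - smoothness.
  - smoothness.
  - intros y Hy. field. now apply H0.
Qed.

(** Smoothness and value are bundled because each rule for the value needs smoothness of the
    operands; a derivative can then be computed by recursion on the expression. *)
Definition has_der (U : phase -> Prop) (D : vector_field) (z : phase)
    (f : phase -> C) (d : C) : Prop := smooth U f /\ D f z = d.

Section has_der_rules.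
Context (U : phase -> Prop) (D : vector_field) (z : phase).
Context (HU : open U) (HD : derivation U D) (Hz : U z).

Lemma has_der_const (w : C) : has_der U D z (fun _ => w) 0.
Proof. split; [smoothness|now apply (der_const U D HD)]. Qed.

Lemma has_der_plus (f g : phase -> C) (a b : C) :
  has_der U D z f a -> has_der U D z g b -> has_der U D z (fun y => f y + g y)%C (a + b)%C.
Proof. intros [Hf <-] [Hg <-]. split; [smoothness|now apply (der_plus U D HD)]. Qed.

Lemma has_der_minus (f g : phase -> C) (a b : C) :
  has_der U D z f a -> has_der U D z g b -> has_der U D z (fun y => f y - g y)%C (a - b)%C.
Proof. intros [Hf <-] [Hg <-]. split; [smoothness|now apply (der_minus U D)]. Qed.

Lemma has_der_opp (f : phase -> C) (a : C) :
  has_der U D z f a -> has_der U D z (fun y => - f y)%C (- a)%C.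
Proof. intros [Hf <-]. split; [smoothness|now apply (der_opp U D)]. Qed.

Lemma has_der_mult (f g : phase -> C) (a b : C) :
  has_der U D z f a -> has_der U D z g b ->
  has_der U D z (fun y => f y * g y)%C (a * g z + f z * b)%C.
Proof. intros [Hf <-] [Hg <-]. split; [smoothness|now apply (der_mult U D HD)]. Qed.

Lemma has_der_inv (f : phase -> C) (a : C) :
  (forall z, U z -> f z <> 0) -> has_der U D z f a ->
  has_der U D z (fun y => / f y)%C (- a * (/ f z * / f z))%C.
Proof.
  intros H0 [Hf <-]. split; [now apply smooth_inv|now apply (der_inv U D)].
Qed.

Lemma has_der_div (f g : phase -> C) (a b : C) :
  (forall z, U z -> g z <> 0) -> has_der U D z f a -> has_der U D z g b ->
  has_der U D z (fun y => f y / g y)%C (a * / g z + f z * (- b * (/ g z * / g z)))%C.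
Proof. intros H0 Hf Hg. apply has_der_mult; trivial. now apply has_der_inv. Qed.

(** The factor is written with [Z.of_nat] so that, for a literal exponent, it computes to an integer
    constant known to [ring] and [field]. *)
Lemma has_der_pow (f : phase -> C) (a : C) n :
  has_der U D z f a ->
  has_der U D z (fun y => f y ^ n)%C (IZR (Z.of_nat n) * f z ^ pred n * a)%C.
Proof.
  intros Hf. rewrite <- INR_IZR_INZ. induction n as [|n IH].
  - replace (RtoC (INR 0) * f z ^ pred 0 * a)%C with (RtoC 0) by (simpl; ring).
    apply (has_der_const 1).
  - replace (RtoC (INR (S n)) * f z ^ pred (S n) * a)%C
      with (a * f z ^ n + f z * (INR n * f z ^ pred n * a))%C.
    + exact (has_der_mult f _ _ _ Hf IH).
    + rewrite S_INR, RtoC_plus. destruct n as [|n]; [simpl; ring|].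
      simpl pred. rewrite (Cpow_S _ n). ring.
Qed.

Lemma has_der_eq (f : phase -> C) (a b : C) : has_der U D z f a -> a = b -> has_der U D z f b.
Proof. now intros H <-. Qed.
End has_der_rules.

Ltac has_der_step :=
  match goal with
  | |- has_der _ _ _ (fun y => ?w) _ => apply has_der_const
  | |- has_der ?U ?D ?z (fun y => (@?F y + @?G y)%C) _ => apply (has_der_plus U D z) with (f := F) (g := G)
  | |- has_der ?U ?D ?z (fun y => (@?F y - @?G y)%C) _ => apply (has_der_minus U D z) with (f := F) (g := G)
  | |- has_der ?U ?D ?z (fun y => (@?F y * @?G y)%C) _ => apply (has_der_mult U D z) with (f := F) (g := G)
  | |- has_der ?U ?D ?z (fun y => (@?F y / @?G y)%C) _ => apply (has_der_div U D z) with (f := F) (g := G)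
  | |- has_der ?U ?D ?z (fun y => (- @?F y)%C) _ => apply (has_der_opp U D z) with (f := F)
  | |- has_der ?U ?D ?z (fun y => (/ @?F y)%C) _ => apply (has_der_inv U D z) with (f := F)
  | |- has_der ?U ?D ?z (fun y => (@?F y ^ ?n)%C) _ => apply (has_der_pow U D z) with (f := F)
  | |- has_der ?U ?D ?z (fun y => ?f y) ?d => change (has_der U D z f d)
  | |- _ => eassumption
  end.

Ltac has_der_compute := eapply has_der_eq; [repeat has_der_step; try eassumption|].

(* [s], [r], [e], [sg] and [t] of the introduction; [sumfun] is minus the sum of the [y_i]. *)
Definition sfun (z : phase) : C :=
  ((u I1 z ^ 2 * p I1 z - u I2 z ^ 2 * p I2 z) / (RtoC (u I1 z) - u I2 z))%C.
Definition rfun (z : phase) : C :=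
  (u I1 z * u I2 z * (u I1 z * p I1 z - u I2 z * p I2 z) / (RtoC (u I1 z) - u I2 z))%C.
Definition efun (z : phase) : C := (/ (u I1 z * u I2 z))%C.
Definition sumfun (b c : R) (z : phase) : C := (b / c + / u I1 z + / u I2 z)%C.
Definition prodfun (a c : R) (z : phase) : C := ((a - sfun z ^ 2) / (c * efun z))%C.

(** * Poisson brackets of the generating functions *)

Lemma regular_neq z : regular z ->
  RtoC (u I1 z) <> 0 /\ RtoC (u I2 z) <> 0 /\ (RtoC (u I1 z) - u I2 z)%C <> 0.
Proof.
  intros [H [H1 H2]]. split; [|split]; try now apply RtoC_neq_0.
  rewrite <- RtoC_minus. apply RtoC_neq_0. lra.
Qed.

Lemma efun_neq_0 z : regular z -> efun z <> 0.
Proof.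
  intros Hz. destruct (regular_neq z Hz) as [H1 [H2 _]].
  intros E. apply (Cmult_neq_0 _ _ H1 H2).
  transitivity ((u I1 z * u I2 z) * (u I1 z * u I2 z) * efun z)%C.
  - unfold efun. field. now split.
  - rewrite E. ring.
Qed.

(** The values [du1], [du2], [dp1], [dp2] of the derivation on the coordinates are kept symbolic, so
    one computation of the differentials serves for all four coordinates. *)
Lemma partial_functions (b c : R) z : regular z ->
  let u1 := RtoC (u I1 z) in let u2 := RtoC (u I2 z) in
  let p1 := RtoC (p I1 z) in let p2 := RtoC (p I2 z) in
  let k1 (k l : coord) : C := if coord_eq_dec k l then RtoC 1 else RtoC 0 in
  forall k,
  let du1 := k1 k (Pos I1) in let du2 := k1 k (Pos I2) in
  let dp1 := k1 k (Mom I1) in let dp2 := k1 k (Mom I2) in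
  has_der regular (partial k) z sfun
    ((2 * u1 * p1 * du1 + u1 ^ 2 * dp1 - 2 * u2 * p2 * du2 - u2 ^ 2 * dp2) / (u1 - u2)
     - (u1 ^ 2 * p1 - u2 ^ 2 * p2) * (du1 - du2) / (u1 - u2) ^ 2)%C /\
  has_der regular (partial k) z rfun
    ((2 * u1 * u2 * p1 * du1 + u1 ^ 2 * p1 * du2 + u1 ^ 2 * u2 * dp1
      - 2 * u1 * u2 * p2 * du2 - u2 ^ 2 * p2 * du1 - u1 * u2 ^ 2 * dp2) / (u1 - u2)
     - u1 * u2 * (u1 * p1 - u2 * p2) * (du1 - du2) / (u1 - u2) ^ 2)%C /\
  has_der regular (partial k) z efun
    (- (du1 / u1 + du2 / u2) / (u1 * u2))%C /\
  has_der regular (partial k) z (sumfun b c)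
    (- (du1 / u1 ^ 2 + du2 / u2 ^ 2))%C.
Proof.
  intros Hz u1 u2 p1 p2 k1 k du1 du2 dp1 dp2.
  assert (HU := open_regular).
  assert (HD := derivation_partial regular k HU).
  assert (HG : forall l, has_der regular (partial k) z (fun y => RtoC (get l y)) (k1 k l)).
  { intros l. split; [now apply smooth_get|]. apply is_partial_unique, is_partial_get. }
  pose proof (HG (Pos I1)) as Hu1. pose proof (HG (Pos I2)) as Hu2.
  pose proof (HG (Mom I1)) as Hp1. pose proof (HG (Mom I2)) as Hp2.
  change (has_der regular (partial k) z (fun y => RtoC (u I1 y)) du1) in Hu1.
  change (has_der regular (partial k) z (fun y => RtoC (u I2 y)) du2) in Hu2.
  change (has_der regular (partial k) z (fun y => RtoC (p I1 y)) dp1) in Hp1.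
  change (has_der regular (partial k) z (fun y => RtoC (p I2 y)) dp2) in Hp2.
  clear HG.
  destruct (regular_neq z Hz) as [H1 [H2 H3]].
  assert (H3' : forall z, regular z -> (RtoC (u I1 z) - u I2 z)%C <> 0)
    by (intros y Hy; apply (regular_neq y Hy)).
  assert (H1' : forall z, regular z -> RtoC (u I1 z) <> 0)
    by (intros y Hy; apply (regular_neq y Hy)).
  assert (H2' : forall z, regular z -> RtoC (u I2 z) <> 0)
    by (intros y Hy; apply (regular_neq y Hy)).
  assert (H12' : forall z, regular z -> (RtoC (u I1 z) * u I2 z)%C <> 0)
    by (intros y Hy; apply Cmult_neq_0; auto).
  clearbody du1 du2 dp1 dp2.
  unfold sfun, rfun, efun, sumfun. 
  split; [|split; [|split]].
  - unfold sfun. has_der_compute.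
    fold u1 u2 p1 p2. fold u1 u2 in H1, H2, H3. clearbody u1 u2 p1 p2. simpl. field. trivial.
  - unfold rfun. has_der_compute.
    fold u1 u2 p1 p2. fold u1 u2 in H1, H2, H3. clearbody u1 u2 p1 p2. simpl. field. trivial.
  - unfold efun. has_der_compute.
    fold u1 u2 p1 p2. fold u1 u2 in H1, H2, H3. clearbody u1 u2 p1 p2. simpl. field. auto.
  - unfold sumfun. has_der_compute.
    fold u1 u2 p1 p2. fold u1 u2 in H1, H2, H3. clearbody u1 u2 p1 p2. simpl. field. auto.
Qed.

Lemma canonical_functions (b c : R) z : regular z ->
  canonical (sumfun b c) sfun z = 0 /\ canonical (sumfun b c) rfun z = 1 /\
  canonical (sumfun b c) efun z = 0 /\ canonical efun sfun z = (- efun z)%C /\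
  canonical efun rfun z = 0 /\ canonical sfun rfun z = 0.
Proof.
  intros Hz. unfold canonical.
  destruct (partial_functions b c z Hz (Pos I1)) as [[_ ->] [[_ ->] [[_ ->] [_ ->]]]].
  destruct (partial_functions b c z Hz (Pos I2)) as [[_ ->] [[_ ->] [[_ ->] [_ ->]]]].
  destruct (partial_functions b c z Hz (Mom I1)) as [[_ ->] [[_ ->] [[_ ->] [_ ->]]]].
  destruct (partial_functions b c z Hz (Mom I2)) as [[_ ->] [[_ ->] [[_ ->] [_ ->]]]].
  destruct (regular_neq z Hz) as [H1 [H2 H3]].
  unfold efun.
  generalize dependent (RtoC (u I1 z)). intros u1. generalize dependent (RtoC (u I2 z)).
  intros u2. generalize (RtoC (p I1 z)) (RtoC (p I2 z)). intros p1 p2 H2 H1 H3.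
  repeat (destruct coord_eq_dec; try congruence).
  repeat split; field; auto.
Qed.

(** * The two Hamiltonians as functions of the generators, and their involution *)

Lemma Csub_neq_sym (x y : C) : (x - y)%C <> 0 -> (y - x)%C <> 0.
Proof.
  intros H E. apply H. replace (x - y)%C with (- (y - x))%C by ring. rewrite E. ring.
Qed.

Lemma Csub_neq_0 (x y : C) : x <> y -> (x - y)%C <> 0.
Proof.
  intros H E. apply H. replace x with (x - y + y)%C by ring. rewrite E. ring.
Qed.

(** This is [2 (lambda_1 + lambda_2)] with the power sums of the roots [y_i] expressed through
    [y_1 + y_2 = - sg] and [y_1 y_2 = t]. *)
Definition ham1 (b c : R) (s r e sg t : C) : C :=
  (2 * c * e * sg - 4 * s * r - (c * e + r ^ 2) * sg - b * (sg ^ 2 - 2 * t)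
   + c * (sg ^ 3 - 3 * sg * t))%C.

(** This is [4 (lambda_1 - lambda_2)^2]: the first factor is the discriminant [(y_1 - y_2)^2], and
    the squared one is the divided difference of [2 lambda] between the two roots. *)
Definition ham2 (b c : R) (r e sg t : C) : C :=
  ((sg ^ 2 - 4 * t) * (c * e + r ^ 2 + b * sg - c * (sg ^ 2 - t)) ^ 2)%C.

Lemma Hhat1_formula (a b c : R) z : c <> 0 -> regular z ->
  RtoC (Hhat1 a b c z) =
  ham1 b c (sfun z) (rfun z) (efun z) (sumfun b c z) (prodfun a c z).
Proof.
  intros Hc Hz. apply RtoC_neq_0 in Hc. destruct (regular_neq z Hz) as [H1 [H2 H3]].
  pose proof (Csub_neq_sym _ _ H3).
  unfold Hhat1, ham1, prodfun, sumfun, efun, sfun, rfun; cbv zeta.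
  push_RtoC. field. auto.
Qed.

Lemma Hhat2_formula (a b c : R) z : c <> 0 -> regular z ->
  RtoC (Hhat2 a b c z) =
  ham2 b c (rfun z) (efun z) (sumfun b c z) (prodfun a c z).
Proof.
  intros Hc Hz. apply RtoC_neq_0 in Hc. destruct (regular_neq z Hz) as [H1 [H2 H3]].
  unfold Hhat2, ham2, prodfun, sumfun, efun, sfun, rfun; cbv zeta.
  push_RtoC. field. auto.
Qed.

Lemma smooth_functions (b c : R) :
  smooth regular sfun /\ smooth regular rfun /\ smooth regular efun /\
  smooth regular (sumfun b c).
Proof.
  assert (HU := open_regular).
  assert (Hd : forall z, regular z -> (RtoC (u I1 z) - u I2 z)%C <> 0)
    by (intros z Hz; apply (regular_neq z Hz)).
  assert (H1 : forall z, regular z -> RtoC (u I1 z) <> 0)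
    by (intros z Hz; apply (regular_neq z Hz)).
  assert (H2 : forall z, regular z -> RtoC (u I2 z) <> 0)
    by (intros z Hz; apply (regular_neq z Hz)).
  assert (H12 : forall z, regular z -> (RtoC (u I1 z) * u I2 z)%C <> 0)
    by (intros z Hz; apply Cmult_neq_0; auto).
  pose proof (smooth_get regular (Pos I1) HU : smooth regular (fun z => RtoC (u I1 z))).
  pose proof (smooth_get regular (Pos I2) HU : smooth regular (fun z => RtoC (u I2 z))).
  pose proof (smooth_get regular (Mom I1) HU : smooth regular (fun z => RtoC (p I1 z))).
  pose proof (smooth_get regular (Mom I2) HU : smooth regular (fun z => RtoC (p I2 z))).
  unfold sfun, rfun, efun, sumfun, Cdiv.
  repeat split; repeat first [progress smoothness | apply smooth_inv]; assumption.
Qed.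

Lemma smooth_prodfun (a c : R) : c <> 0 -> smooth regular (prodfun a c).
Proof.
  intros Hc. destruct (smooth_functions 0 c) as [Hs [_ [He _]]].
  assert (HU := open_regular).
  unfold prodfun, Cdiv. smoothness. apply smooth_inv; smoothness.
  intros z Hz. apply Cmult_neq_0; [now apply RtoC_neq_0|now apply efun_neq_0].
Qed.

Lemma canonical_self f z : canonical f f z = 0.
Proof. unfold canonical. ring. Qed.

(** [t] depends on [s] and [e] alone, so its brackets follow from theirs by the quotient rule
    [K]. *)
Lemma canonical_prodfun (a b c : R) z : c <> 0 -> regular z ->
  canonical (prodfun a c) sfun z = prodfun a c z /\
  canonical (prodfun a c) rfun z = 0 /\
  canonical (prodfun a c) (sumfun b c) z = 0 /\
  canonical (prodfun a c) efun z = (- 2 * sfun z / c)%C.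
Proof.
  intros Hc Hz.
  destruct (smooth_functions b c) as [Hs [Hr [He Hg]]].
  destruct (canonical_functions b c z Hz) as [Egs [Egr [Ege [Ees [Eer Esr]]]]].
  assert (Hc' := RtoC_neq_0 _ Hc).
  assert (He0 := efun_neq_0 z Hz).
  assert (HU := open_regular).
  assert (Hd : forall z, regular z -> (c * efun z)%C <> 0)
    by (intros y Hy; apply Cmult_neq_0; [|apply efun_neq_0]; trivial).
  assert (K : forall h (ds de : C), smooth regular h ->
    canonical sfun h z = ds -> canonical efun h z = de ->
    canonical (prodfun a c) h z =
      ((- 2 * sfun z * ds) / (c * efun z)
       - prodfun a c z * de / efun z)%C).
  { intros h ds de Hh Eds Ede.
    assert (HD := derivation_canonical_l regular h HU Hh).
    enough (H : has_der regular (fun f => canonical f h) z (prodfun a c)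
      ((- 2 * sfun z * ds) / (c * efun z) - prodfun a c z * de / efun z)%C)
      by apply H.
    assert (Ls : has_der regular (fun f => canonical f h) z sfun ds) by now split.
    assert (Le : has_der regular (fun f => canonical f h) z efun de) by now split.
    unfold prodfun. has_der_compute. simpl. field. auto. }
  repeat split.
  - rewrite (K sfun 0 (- efun z)%C); trivial; [field; auto|apply canonical_self].
  - rewrite (K rfun 0 0); trivial. field; auto.
  - rewrite (K (sumfun b c) 0 0); trivial; [field; auto| |];
      rewrite canonical_skew, ?Egs, ?Ege; ring.
  - rewrite (K efun (efun z) 0); trivial; [field; auto| |].
    + rewrite canonical_skew, Ees. ring.
    + apply canonical_self.
Qed.

(** The chain rule is applied twice: first to [h2], giving its bracket with each generator, then to
    [h1]. Since no root is chosen, the result covers all regular points. *)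
Lemma Hhat_involution (a b c : R) : c <> 0 ->
  in_involution regular (Hhat1 a b c) (Hhat2 a b c).
Proof.
  intros Hc z Hz.
  assert (HU := open_regular).
  destruct (smooth_functions b c) as [Hs [Hr [He Hg]]].
  assert (Ht := smooth_prodfun a c Hc).
  destruct (canonical_functions b c z Hz) as [Egs [Egr [Ege [Ees [Eer Esr]]]]].
  destruct (canonical_prodfun a b c z Hc Hz) as [Ets [Etr [Etg Ete]]].
  set (s := sfun) in *. set (r := rfun) in *. set (e := efun) in *.
  set (g := sumfun b c) in *. set (t := prodfun a c) in *.
  set (h1 := fun z => ham1 b c (s z) (r z) (e z) (g z) (t z)).
  set (h2 := fun z => ham2 b c (r z) (e z) (g z) (t z)).
  assert (S1 : smooth regular h1) by (unfold h1, ham1; smoothness).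
  assert (S2 : smooth regular h2) by (unfold h2, ham2; smoothness).
  assert (HP := is_poisson_canonical regular HU).
  (* The formulas in the generators hold on regular points only, hence the appeal to locality. *)
  rewrite (pb_local _ _ HP _ h1 _ h2); trivial;
    try (intros y Hy; now first [apply Hhat1_formula|apply Hhat2_formula]);
    try (apply smooth_ext_on with (3 := S1); trivial;
      intros y Hy; symmetry; now apply Hhat1_formula);
    try (apply smooth_ext_on with (3 := S2); trivial;
      intros y Hy; symmetry; now apply Hhat2_formula).
  assert (L : forall f v, smooth regular f -> canonical f h2 z = v ->
    has_der regular (fun f => canonical f h2) z f v) by (intros; now split).
  (* The chain rule for [h2], for an arbitrary first argument whose brackets with the five
     generators are known. *)
  assert (K : forall f ds dr de dg dt, smooth regular f ->
    canonical f s z = ds -> canonical f r z = dr -> canonical f e z = de ->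
    canonical f g z = dg -> canonical f t z = dt ->
    canonical f h2 z =
     ((2 * g z * dg - 4 * dt) * (c * e z + r z ^ 2 + b * g z - c * (g z ^ 2 - t z)) ^ 2
      + (g z ^ 2 - 4 * t z) * (2 * (c * e z + r z ^ 2 + b * g z - c * (g z ^ 2 - t z)))
        * (c * de + 2 * r z * dr + b * dg - c * (2 * g z * dg - dt)))%C).
  { intros f ds dr de dg dt Sf Es Er Ee Eg Et.
    assert (HD := derivation_canonical_r regular f HU Sf).
    assert (Ls : has_der regular (canonical f) z s ds) by now split.
    assert (Lr : has_der regular (canonical f) z r dr) by now split.
    assert (Le : has_der regular (canonical f) z e de) by now split.
    assert (Lg : has_der regular (canonical f) z g dg) by now split.
    assert (Lt : has_der regular (canonical f) z t dt) by now split.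
    match goal with |- _ = ?v =>
      enough (H : has_der regular (canonical f) z h2 v) by apply H end.
    unfold h2, ham2. has_der_compute. simpl. ring. }
  assert (HD := derivation_canonical_l regular h2 HU S2).
  assert (N : forall f h v, canonical f h z = v -> canonical h f z = (- v)%C)
    by (intros f h v <-; apply canonical_skew).
  pose proof (L _ _ Hs (K s _ _ _ _ _ Hs (canonical_self s z) Esr (N _ _ _ Ees)
    (N _ _ _ Egs) (N _ _ _ Ets))) as Ls.
  pose proof (L _ _ Hr (K r _ _ _ _ _ Hr (N _ _ _ Esr) (canonical_self r z) (N _ _ _ Eer)
    (N _ _ _ Egr) (N _ _ _ Etr))) as Lr.
  pose proof (L _ _ He (K e _ _ _ _ _ He Ees Eer (canonical_self e z)
    (N _ _ _ Ege) (N _ _ _ Ete))) as Le.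
  pose proof (L _ _ Hg (K g _ _ _ _ _ Hg Egs Egr Ege (canonical_self g z)
    (N _ _ _ Etg))) as Lg.
  pose proof (L _ _ Ht (K t _ _ _ _ _ Ht Ets Etr Ete Etg (canonical_self t z))) as Lt.
  enough (H : has_der regular (fun f => canonical f h2) z h1 0) by apply H.
  (* The five generators now enter as independent atoms; the parameter [a] is hidden in [t]. *)
  unfold h1, ham1. has_der_compute. simpl. field. now apply RtoC_neq_0.
Qed.

(** * The new canonical coordinates *)

Lemma RtoC_lead (a : R) z : regular z -> RtoC (lead a z) = (a - sfun z ^ 2)%C.
Proof.
  intros Hz. destruct (regular_neq z Hz) as [_ [_ H3]].
  unfold lead, sfun; cbv zeta. push_RtoC. now field.
Qed.

(** Division of the quadratic by [c x^2 / (u1 u2)] turns its constant term into [(1 / x)^2], so the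
    polynomial for the inverse is monic. *)
Lemma inverse_root (a b c : R) z (x : C) : c <> 0 -> regular z -> x <> 0 ->
  quadratic a b c z x = 0 ->
  ((/ x) ^ 2 + sumfun b c z * / x + prodfun a c z)%C = 0.
Proof.
  intros Hc Hz Hx. apply RtoC_neq_0 in Hc. unfold quadratic; cbv zeta.
  rewrite RtoC_lead by trivial. unfold prodfun, sumfun, efun.
  generalize (sfun z) as s. intros s.
  destruct (regular_neq z Hz) as [H1 [H2 _]].
  intros H.
  match type of H with ?q = _ =>
    transitivity (u I1 z * u I2 z * q / (c * x ^ 2))%C; [|rewrite H]; field; auto end.
Qed.

(** The difference of the two equations is divisible by [x - y], which gives [sg]; either equation
    then gives [t]. *)
Lemma vieta (sg t x y : C) : x <> y ->
  (x ^ 2 + sg * x + t)%C = 0 -> (y ^ 2 + sg * y + t)%C = 0 ->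
  sg = (- (x + y))%C /\ t = (x * y)%C.
Proof.
  intros Hxy Hx Hy. apply Csub_neq_0 in Hxy.
  assert (E : sg = (- (x + y))%C).
  { transitivity (((x ^ 2 + sg * x + t) - (y ^ 2 + sg * y + t)) / (x - y) - (x + y))%C;
      [now field|]. rewrite Hx, Hy. now field. }
  split; trivial.
  transitivity ((x ^ 2 + sg * x + t) + x * y - x * (sg + x + y))%C; [ring|].
  rewrite Hx, E. ring.
Qed.

Definition yfun (uh : idx -> phase -> C) (i : idx) (z : phase) : C := (/ uh i z)%C.

(** The Vieta relations take over from the quadratic: below, the roots are tied to the old
    coordinates through [sumfun] and [prodfun]. *)
Record inverse_roots (a b c : R) (U : phase -> Prop) (uh : idx -> phase -> C) : Prop := {
  ir_open : open U;
  ir_regular : forall z, U z -> regular z;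
  ir_smooth : forall i, smooth U (uh i);
  ir_smooth_inv : forall i, smooth U (yfun uh i);
  ir_neq_0 : forall i z, U z -> uh i z <> 0;
  ir_inv_neq_0 : forall i z, U z -> yfun uh i z <> 0;
  ir_neq : forall z, U z -> yfun uh I1 z <> yfun uh I2 z;
  ir_sum : forall z, U z -> sumfun b c z = (- (yfun uh I1 z + yfun uh I2 z))%C;
  ir_prod : forall z, U z -> prodfun a c z = (yfun uh I1 z * yfun uh I2 z)%C
}.

Lemma Cinv_neq_0 (x : C) : x <> 0 -> (/ x)%C <> 0.
Proof.
  intros Hx E. apply C1_nz. transitivity (x * / x)%C; [now field|]. rewrite E. ring.
Qed.

Lemma root_branches_inverse (a b c : R) U uh : c <> 0 ->
  root_branches a b c U uh -> inverse_roots a b c U uh.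
Proof.
  intros Hc [HU [Hs HR]].
  assert (H0 : forall i z, U z -> uh i z <> 0)
    by (intros i z Hz; now apply (HR z Hz)).
  assert (Hn : forall z, U z -> yfun uh I1 z <> yfun uh I2 z).
  { intros z Hz E. apply (HR z Hz). unfold yfun in E.
    transitivity (/ / uh I1 z)%C; [|rewrite E]; field; auto. }
  assert (HV : forall z, U z -> sumfun b c z = (- (yfun uh I1 z + yfun uh I2 z))%C /\
    prodfun a c z = (yfun uh I1 z * yfun uh I2 z)%C).
  { intros z Hz. destruct (HR z Hz) as [Hreg [_ [Hq _]]].
    apply vieta; [now apply Hn| |]; apply inverse_root; auto; apply Hq. }
  split; trivial.
  - intros z Hz. apply (HR z Hz).
  - intros i. apply smooth_inv; auto.
  - intros i z Hz. apply Cinv_neq_0. auto.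
  - intros z Hz. apply (HV z Hz).
  - intros z Hz. apply (HV z Hz).
Qed.

(** Differentiating the two Vieta relations gives a linear system for the derivatives of the roots,
    whose determinant is [y_1 - y_2] up to sign. *)
Lemma has_der_roots a b c U uh D z ds dt :
  inverse_roots a b c U uh -> derivation U D -> U z ->
  has_der U D z (sumfun b c) ds -> has_der U D z (prodfun a c) dt ->
  has_der U D z (yfun uh I1)
    (- (yfun uh I1 z * ds + dt) / (yfun uh I1 z - yfun uh I2 z))%C /\
  has_der U D z (yfun uh I2)
    ((yfun uh I2 z * ds + dt) / (yfun uh I1 z - yfun uh I2 z))%C.
Proof.
  intros HI HD Hz [Ss Es] [St Et].
  assert (HU := ir_open _ _ _ _ _ HI).
  assert (Hy := ir_smooth_inv _ _ _ _ _ HI).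
  set (y1 := yfun uh I1) in *. set (y2 := yfun uh I2) in *.
  assert (S1 : smooth U y1) by apply Hy. assert (S2 : smooth U y2) by apply Hy.
  assert (Hn := Csub_neq_0 _ _ (ir_neq _ _ _ _ _ HI z Hz)). fold y1 y2 in Hn.
  assert (L1 : has_der U D z y1 (D y1 z)) by now split.
  assert (L2 : has_der U D z y2 (D y2 z)) by now split.
  assert (Es' : ds = (- (D y1 z + D y2 z))%C).
  { rewrite <- Es, (der_local U D HD _ (fun z => - (y1 z + y2 z))%C); trivial;
      [|smoothness|apply (ir_sum _ _ _ _ _ HI)].
    enough (H : has_der U D z (fun z => - (y1 z + y2 z))%C (- (D y1 z + D y2 z))%C)
      by apply H.
    has_der_compute. reflexivity. }
  assert (Et' : dt = (D y1 z * y2 z + y1 z * D y2 z)%C).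
  { rewrite <- Et, (der_local U D HD _ (fun z => y1 z * y2 z)%C); trivial;
      [|smoothness|apply (ir_prod _ _ _ _ _ HI)].
    now apply (der_mult U D HD). }
  rewrite Es', Et'. split; (split; [trivial|]); now field.
Qed.

Definition pfun (uh : idx -> phase -> C) (i : idx) (z : phase) : C :=
  (rfun z * yfun uh i z ^ 2 - sfun z * yfun uh i z)%C.

(** The second factor of [Q] is the linear polynomial [s x - r]. *)
Lemma ph_pfun a b c U uh i z : inverse_roots a b c U uh -> U z ->
  ph uh i z = pfun uh i z.
Proof.
  intros HI Hz.
  destruct (regular_neq z (ir_regular _ _ _ _ _ HI z Hz)) as [H1 [H2 H3]].
  assert (H := ir_neq_0 _ _ _ _ _ HI i z Hz).
  pose proof (Csub_neq_sym _ _ H3).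
  unfold ph, pfun, yfun, Q, rfun, sfun; cbv zeta. field. auto.
Qed.

Lemma lambda_formula a b c U uh i z : c <> 0 -> inverse_roots a b c U uh -> U z ->
  lambda a b c uh i z =
  ((c * efun z * sumfun b c z - 2 * sfun z * rfun z
    + (c * efun z + rfun z ^ 2) * yfun uh i z
    - b * yfun uh i z ^ 2 - c * yfun uh i z ^ 3) / 2)%C.
Proof.
  intros Hc HI Hz.
  assert (Hc' := RtoC_neq_0 _ Hc).
  assert (He := efun_neq_0 z (ir_regular _ _ _ _ _ HI z Hz)).
  unfold lambda; cbv zeta. rewrite (ph_pfun a b c U) by trivial.
  assert (Ex : uh i z = (/ yfun uh i z)%C).
  { unfold yfun. field. now apply (ir_neq_0 _ _ _ _ _ HI). }
  rewrite Ex. unfold pfun.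
  assert (Hy := ir_inv_neq_0 _ _ _ _ _ HI i z Hz).
  (* The root equation, solved for [a]. After this substitution the terms [s^2 / y] coming from
     [x^3 ph^2] and from [a x] cancel, leaving a polynomial in [y]. *)
  assert (Hr : (RtoC a = sfun z ^ 2 - c * efun z * (yfun uh i z ^ 2
    + sumfun b c z * yfun uh i z))%C).
  { transitivity (sfun z ^ 2 + c * efun z * prodfun a c z)%C.
    - unfold prodfun. field. auto.
    - rewrite (ir_prod _ _ _ _ _ HI z Hz), (ir_sum _ _ _ _ _ HI z Hz).
      destruct i; ring. }
  rewrite Hr. field. trivial.
Qed.

Lemma Hhat_lambda a b c U uh z : c <> 0 -> inverse_roots a b c U uh -> U z ->
  RtoC (Hhat1 a b c z) = (2 * (lambda a b c uh I1 z + lambda a b c uh I2 z))%C /\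
  RtoC (Hhat2 a b c z) = (4 * (lambda a b c uh I1 z - lambda a b c uh I2 z) ^ 2)%C.
Proof.
  intros Hc HI Hz.
  assert (Hz' := ir_regular _ _ _ _ _ HI z Hz).
  rewrite Hhat1_formula, Hhat2_formula, !(lambda_formula a b c U uh) by trivial.
  unfold ham1, ham2.
  rewrite (ir_prod _ _ _ _ _ HI z Hz), (ir_sum _ _ _ _ _ HI z Hz).
  assert (RtoC 2 <> 0) by (apply RtoC_neq_0; lra).
  split; field; trivial.
Qed.

(** * Canonical relations for the new coordinates *)

Lemma has_der_of_canonical_l U f g z v :
  smooth U f -> canonical f g z = v -> has_der U (fun f => canonical f g) z f v.
Proof. now split. Qed.

Lemma has_der_of_canonical_r U f g z v :
  smooth U g -> canonical f g z = v -> has_der U (canonical f) z g v.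
Proof. now split. Qed.

(** The relations are first computed for the inverse roots [yfun] and the momenta [pfun], then
    carried over to [uh] by the rule for inverses and to [ph] by locality. *)
Lemma canonical_pairs_roots a b c U uh : c <> 0 -> inverse_roots a b c U uh ->
  canonical_pairs U uh (ph uh).
Proof.
  intros Hc HI.
  assert (HU := ir_open _ _ _ _ _ HI).
  assert (Sy := ir_smooth_inv _ _ _ _ _ HI).
  assert (Sx := ir_smooth _ _ _ _ _ HI).
  assert (Hreg := ir_regular _ _ _ _ _ HI).
  destruct (smooth_functions b c) as [Ss [Sr [_ Sg]]].
  assert (St := smooth_prodfun a c Hc).
  apply (smooth_subset _ U) in Ss, Sr, Sg, St; trivial.
  assert (Sp : forall i, smooth U (pfun uh i)) by (intros i; unfold pfun; smoothness).
  assert (Sph : forall i, smooth U (ph uh i)).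
  { intros i. apply smooth_ext_on with (pfun uh i); trivial.
    intros z Hz. symmetry. now apply (ph_pfun a b c U). }
  split; [trivial|split; [trivial|]].
  assert (HL := fun h => derivation_canonical_l U h HU).
  assert (HR := fun h => derivation_canonical_r U h HU).
  set (dl z := (yfun uh I1 z - yfun uh I2 z)%C).
  assert (Hdl : forall z, U z -> dl z <> 0)
    by (intros z Hz; apply Csub_neq_0, (ir_neq _ _ _ _ _ HI z Hz)).
  (* Implicit differentiation along the fields [{., s}], [{., r}], [{., sg}] and [{., t}]. *)
  assert (Y1 : forall z, U z ->
    canonical (yfun uh I1) sfun z = (- (yfun uh I1 z * yfun uh I2 z) / dl z)%C /\
    canonical (yfun uh I2) sfun z = ((yfun uh I1 z * yfun uh I2 z) / dl z)%C /\
    canonical (yfun uh I1) rfun z = (- yfun uh I1 z / dl z)%C /\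
    canonical (yfun uh I2) rfun z = (yfun uh I2 z / dl z)%C /\
    canonical (yfun uh I1) (sumfun b c) z = 0 /\
    canonical (yfun uh I1) (prodfun a c) z = 0).
  { intros z Hz. pose proof (Hdl z Hz) as Hdlz. unfold dl in *.
    destruct (canonical_functions b c z (Hreg z Hz)) as [Egs [Egr _]].
    destruct (canonical_prodfun a b c z Hc (Hreg z Hz)) as [Ets [Etr [Etg _]]].
    destruct (has_der_roots a b c U uh _ z _ _ HI (HL _ Ss) Hz
      (has_der_of_canonical_l U _ _ z _ Sg Egs)
      (has_der_of_canonical_l U _ _ z _ St Ets)) as [[_ E1] [_ E2]].
    destruct (has_der_roots a b c U uh _ z _ _ HI (HL _ Sr) Hz
      (has_der_of_canonical_l U _ _ z _ Sg Egr)
      (has_der_of_canonical_l U _ _ z _ St Etr)) as [[_ E3] [_ E4]].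
    destruct (has_der_roots a b c U uh _ z _ _ HI (HL _ Sg) Hz
      (has_der_of_canonical_l U _ _ z _ Sg (canonical_self _ z))
      (has_der_of_canonical_l U _ _ z _ St Etg)) as [[_ E5] _].
    assert (Egt : canonical (sumfun b c) (prodfun a c) z = 0)
      by (rewrite canonical_skew, Etg; ring).
    destruct (has_der_roots a b c U uh _ z _ _ HI (HL _ St) Hz
      (has_der_of_canonical_l U _ _ z _ Sg Egt)
      (has_der_of_canonical_l U _ _ z _ St (canonical_self _ z))) as [[_ E6] _].
    rewrite E1, E2, E3, E4, E5, E6, (ir_prod _ _ _ _ _ HI z Hz).
    repeat split; field; trivial. }
  (* The operator [{y_1, .}] kills both [sg] and [t], hence also the root [y_2]. *)
  assert (Y2 : forall z, U z -> canonical (yfun uh I1) (yfun uh I2) z = 0).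
  { intros z Hz. pose proof (Hdl z Hz) as Hdlz. unfold dl in *.
    destruct (Y1 z Hz) as [_ [_ [_ [_ [E5 E6]]]]].
    destruct (has_der_roots a b c U uh _ z _ _ HI (HR _ (Sy I1)) Hz
      (has_der_of_canonical_r U _ _ z _ Sg E5)
      (has_der_of_canonical_r U _ _ z _ St E6)) as [_ [_ E]].
    rewrite E. now field. }
  assert (YY : forall i j z, U z -> canonical (yfun uh i) (yfun uh j) z = 0).
  { intros [] [] z Hz.
    - apply canonical_self.
    - now apply Y2.
    - rewrite canonical_skew, Y2 by trivial. ring.
    - apply canonical_self. }
  (* For [i = 1] the bracket is [- y_1 y_j (y_j - y_2) / (y_1 - y_2)], which vanishes for [j = 2];
     the case [i = 2] is symmetric. *)
  assert (YP : forall i j z, U z -> canonical (yfun uh i) (pfun uh j) z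
    = (- delta i j * yfun uh i z ^ 2)%C).
  { intros i j z Hz. pose proof (Hdl z Hz) as Hdlz.
    destruct (Y1 z Hz) as [E1 [E2 [E3 [E4 _]]]].
    assert (HD := HR _ (Sy i)).
    assert (Ly := has_der_of_canonical_r U _ _ z _ (Sy j) (YY i j z Hz)).
    match goal with |- _ = ?v =>
      enough (H : has_der U (canonical (yfun uh i)) z (pfun uh j) v) by apply H end.
    destruct i;
      [pose proof (has_der_of_canonical_r U _ _ z _ Ss E1) as Ls;
       pose proof (has_der_of_canonical_r U _ _ z _ Sr E3) as Lr
      |pose proof (has_der_of_canonical_r U _ _ z _ Ss E2) as Ls;
       pose proof (has_der_of_canonical_r U _ _ z _ Sr E4) as Lr];
      unfold pfun; has_der_compute; destruct j; simpl; unfold dl in *; now field. }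
  assert (PP : forall i j z, U z -> canonical (pfun uh i) (pfun uh j) z = 0).
  { intros i j z Hz. pose proof (Hdl z Hz) as Hdlz.
    destruct (Y1 z Hz) as [E1 [E2 [E3 [E4 _]]]].
    destruct (canonical_functions b c z (Hreg z Hz)) as [_ [_ [_ [_ [_ Esr]]]]].
    assert (Ers : canonical rfun sfun z = 0) by (rewrite canonical_skew, Esr; ring).
    (* The brackets of [s] and [r] with [y_j] are named, so that the momenta can be differentiated
       before a value of [j] is chosen; the table [Y1] is inserted only at the end. *)
    assert (SY : exists v, canonical sfun (yfun uh j) z = v /\
      canonical (yfun uh j) sfun z = (- v)%C)
      by (eexists; split; [reflexivity|apply canonical_skew]).
    assert (RY : exists v, canonical rfun (yfun uh j) z = v /\
      canonical (yfun uh j) rfun z = (- v)%C)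
      by (eexists; split; [reflexivity|apply canonical_skew]).
    destruct SY as [sy [SY SY']], RY as [ry [RY RY']].
    assert (LSp : canonical sfun (pfun uh j) z =
      ((2 * rfun z * yfun uh j z - sfun z) * sy)%C).
    { assert (HD := HR _ Ss).
      assert (Ly := has_der_of_canonical_r U _ _ z _ (Sy j) SY).
      pose proof (has_der_of_canonical_r U _ _ z _ Ss (canonical_self sfun z)).
      pose proof (has_der_of_canonical_r U _ _ z _ Sr Esr).
      match goal with |- _ = ?v =>
        enough (H' : has_der U (canonical sfun) z (pfun uh j) v) by apply H' end.
      unfold pfun; has_der_compute. simpl. ring. }
    assert (LRp : canonical rfun (pfun uh j) z =
      ((2 * rfun z * yfun uh j z - sfun z) * ry)%C).
    { assert (HD := HR _ Sr).
      assert (Ly := has_der_of_canonical_r U _ _ z _ (Sy j) RY).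
      pose proof (has_der_of_canonical_r U _ _ z _ Sr (canonical_self rfun z)).
      pose proof (has_der_of_canonical_r U _ _ z _ Ss Ers).
      match goal with |- _ = ?v =>
        enough (H' : has_der U (canonical rfun) z (pfun uh j) v) by apply H' end.
      unfold pfun; has_der_compute. simpl. ring. }
    assert (HD := HL _ (Sp j)).
    pose proof (has_der_of_canonical_l U _ _ z _ Ss LSp).
    pose proof (has_der_of_canonical_l U _ _ z _ Sr LRp).
    pose proof (has_der_of_canonical_l U _ _ z _ (Sy i) (YP i j z Hz)).
    enough (H' : has_der U (fun f => canonical f (pfun uh j)) z (pfun uh i) 0)
      by apply H'.
    assert (Esy : sy = (- canonical (yfun uh j) sfun z)%C) by (rewrite SY'; ring).
    assert (Ery : ry = (- canonical (yfun uh j) rfun z)%C) by (rewrite RY'; ring).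
    unfold pfun at 2. has_der_compute.
    rewrite Esy, Ery.
    destruct i, j; rewrite ?E1, ?E2, ?E3, ?E4; simpl; unfold dl in *; now field. }
  assert (EP : forall f f' i z, smooth U f -> smooth U f' -> U z ->
    (forall z, U z -> f z = f' z) ->
    canonical f (ph uh i) z = canonical f' (pfun uh i) z).
  { intros f f' i z Sf Sf' Hz Ef.
    apply (pb_local U _ (is_poisson_canonical U HU)); trivial.
    intros; now apply (ph_pfun a b c U). }
  assert (XY : forall i z, U z -> (/ yfun uh i z)%C = uh i z).
  { intros i z Hz. unfold yfun. field. now apply (ir_neq_0 _ _ _ _ _ HI). }
  assert (Hy0 : forall i z, U z -> yfun uh i z <> 0)
    by (intros; now apply (ir_inv_neq_0 _ _ _ _ _ HI)).
  (* Passage from [y_i] to [uh i]. For the bracket with the momentum, the factor [- uh^2] cancels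
     the [- y^2] found in [YP]. *)
  assert (HX : forall i D z v, derivation U D -> U z -> D (yfun uh i) z = v ->
    D (uh i) z = (- v * uh i z ^ 2)%C).
  { intros i D z v HD Hz <-.
    rewrite <- (der_local U D HD _ _ z (smooth_inv U _ HU (Hy0 i) (Sy i)) (Sx i) (XY i) Hz).
    rewrite (der_inv U D) by auto. rewrite !XY by trivial. ring. }
  intros i j z Hz. split; [|split].
  - rewrite (EP _ (uh i)) by auto.
    rewrite (HX i _ z _ (HL _ (Sp j)) Hz (YP i j z Hz)). rewrite <- XY by trivial.
    field. auto.
  - rewrite (HX i _ z _ (HL _ (Sx j)) Hz eq_refl). rewrite (HX j _ z _ (HR _ (Sy i)) Hz (YY i j z Hz)).
    ring.
  - rewrite (EP _ (pfun uh i)); auto. intros; now apply (ph_pfun a b c U).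
Qed.

(** * The bi-Hamiltonian structure *)

(** These are the weights of an arbitrary linear combination of the two brackets. *)
Lemma separated_pencil U D lam (s t : C) :
  open U -> frame U D -> (forall i, smooth U (lam i)) ->
  (forall i z, U z -> lam i z <> 0) -> separated U D lam ->
  separated U D (fun i z => s + t * / lam i z)%C.
Proof.
  intros HU HD Hs H0 Hsep i j z Hz Hij.
  assert (HDk := frame_der _ _ HD).
  assert (K : forall k, D k (lam i) z = 0 -> D k (fun z => s + t * / lam i z)%C z = 0).
  { intros k Ek. assert (HDk' := HDk k).
    assert (L : has_der U (D k) z (lam i) 0) by now split.
    assert (H0' := H0 i).
    enough (H : has_der U (D k) z (fun z => s + t * / lam i z)%C 0) by apply H.
    has_der_compute. ring. }
  destruct (Hsep i j z Hz Hij) as [E1 E2]. split; now apply K.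
Qed.

(** In the common frame the canonical bracket has weights one and [br'] has weights [1 / lam i], so
    each linear combination is again a frame bracket with separated weights and compatibility is an
    instance of one lemma. *)
Lemma bi_hamiltonian_separated U x q lam H :
  open U -> canonical_pairs U x q -> (forall i, smooth U (lam i)) ->
  (forall i z, U z -> lam i z <> 0) -> separated U (pair_frame x q) lam ->
  (forall z, U z -> H z = (2 * (lam I1 z + lam I2 z))%C) ->
  let br' := frame_bracket (pair_frame x q) (fun i z => / lam i z)%C in
  is_poisson_bracket U br' /\
  (forall i j z, U z ->
    br' (x i) (q j) z = (/ lam i z * delta i j)%C /\
    br' (x i) (x j) z = 0 /\ br' (q i) (q j) z = 0) /\
  bi_hamiltonian U canonical br' (hamiltonian_field canonical H).
Proof.
  intros HU Hxq Hs H0 Hsep HH br'.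
  assert (HF := frame_pair_frame U x q HU Hxq).
  assert (Hpencil : forall s t : C, is_poisson_bracket U
    (fun f g z => s * canonical f g z + t * br' f g z)%C).
  { intros s t.
    apply is_poisson_bracket_ext with
      (frame_bracket (pair_frame x q) (fun i z => s + t * / lam i z)%C); trivial.
    - intros f g z Hf Hg Hz. rewrite (canonical_pair_frame U x q f g z Hxq Hz).
      unfold br', frame_bracket. ring.
    - apply is_poisson_frame_bracket; trivial.
      + intros i. assert (smooth U (fun z => / lam i z)%C) by (apply smooth_inv; auto).
        smoothness.
      + now apply separated_pencil. }
  assert (Hbr' : is_poisson_bracket U br').
  { apply (is_poisson_bracket_ext U _ br' HU) with (2 := Hpencil 0 1).
    intros; ring. }
  assert (Hcan := is_poisson_canonical U HU).
  assert (SH : smooth U H).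
  { apply smooth_ext_on with (fun z => 2 * (lam I1 z + lam I2 z))%C; trivial;
      [now symmetry; apply HH|smoothness]. }
  split; [trivial|split; [|split; [|split]]].
  - intros i j z Hz. destruct Hxq as [_ [_ Hxq]].
    unfold br', frame_bracket, pair_frame.
    destruct (Hxq i I1 z Hz) as [A1 [B1 C1]], (Hxq i I2 z Hz) as [A2 [B2 C2]].
    destruct (Hxq j I1 z Hz) as [A3 [B3 C3]], (Hxq j I2 z Hz) as [A4 [B4 C4]].
    destruct (Hxq I1 i z Hz) as [A5 [B5 C5]], (Hxq I2 i z Hz) as [A6 [B6 C6]].
    destruct (Hxq I1 j z Hz) as [A7 [B7 C7]], (Hxq I2 j z Hz) as [A8 [B8 C8]].
    rewrite A1, A2, A3, A4, A5, A6, A7, A8, B5, B6, B7, B8, C1, C2, C3, C4.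
    destruct i, j; simpl; repeat split; ring.
  - split; [|split]; trivial.
  - exists H. split; trivial.
  (* Any derivative of [lam i ^ 2], weighted by [1 / lam i], is the corresponding derivative of
     [2 lam i]; separation removes the mixed terms. *)
  - exists (fun z => lam I1 z ^ 2 + lam I2 z ^ 2)%C. split; [smoothness|].
    intros f Hf z Hz. unfold hamiltonian_field.
    rewrite (pb_local U _ Hcan f f H (fun z => 2 * (lam I1 z + lam I2 z))%C);
      trivial; [|smoothness].
    rewrite (canonical_pair_frame U x q _ _ z Hxq Hz).
    assert (K1 : forall k, pair_frame x q k (fun z => 2 * (lam I1 z + lam I2 z))%C z =
      (2 * (pair_frame x q k (lam I1) z + pair_frame x q k (lam I2) z))%C).
    { intros k. assert (HD := frame_der _ _ HF k).
      pose proof (conj (Hs I1) eq_refl : has_der U (pair_frame x q k) z (lam I1) _).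
      pose proof (conj (Hs I2) eq_refl : has_der U (pair_frame x q k) z (lam I2) _).
      match goal with |- pair_frame _ _ _ ?g _ = ?v =>
        enough (H' : has_der U (pair_frame x q k) z g v) by apply H' end.
      has_der_compute. ring. }
    assert (K2 : forall k, pair_frame x q k (fun z => lam I1 z ^ 2 + lam I2 z ^ 2)%C z =
      (2 * (lam I1 z * pair_frame x q k (lam I1) z
        + lam I2 z * pair_frame x q k (lam I2) z))%C).
    { intros k. assert (HD := frame_der _ _ HF k).
      pose proof (conj (Hs I1) eq_refl : has_der U (pair_frame x q k) z (lam I1) _).
      pose proof (conj (Hs I2) eq_refl : has_der U (pair_frame x q k) z (lam I2) _).
      match goal with |- pair_frame _ _ _ ?g _ = ?v =>
        enough (H' : has_der U (pair_frame x q k) z g v) by apply H' end.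
      has_der_compute. simpl. ring. }
    unfold br', frame_bracket. rewrite !K1, !K2.
    destruct (Hsep I1 I2 z Hz ltac:(discriminate)) as [-> ->].
    destruct (Hsep I2 I1 z Hz ltac:(discriminate)) as [-> ->].
    pose proof (H0 I1 z Hz). pose proof (H0 I2 z Hz).
    generalize dependent (lam I1 z). generalize dependent (lam I2 z).
    intros. field. auto.
Qed.

Lemma smooth_lambda a b c U uh i : c <> 0 -> inverse_roots a b c U uh ->
  smooth U (lambda a b c uh i).
Proof.
  intros Hc HI.
  assert (HU := ir_open _ _ _ _ _ HI).
  assert (Sy := ir_smooth_inv _ _ _ _ _ HI).
  destruct (smooth_functions b c) as [Ss [Sr [Se Sg]]].
  apply (smooth_subset _ U) in Ss, Sr, Se, Sg; try apply (ir_regular _ _ _ _ _ HI).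
  eapply (smooth_ext_on U _ _ HU
    (fun z Hz => eq_sym (lambda_formula a b c U uh i z Hc HI Hz))).
  unfold Cdiv. smoothness.
Qed.

(** [lambda i] is an expression in [uh i] and [ph i] alone, and the fields of the other pair kill
    both by the canonical relations. *)
Lemma separated_lambda a b c U uh : c <> 0 -> inverse_roots a b c U uh ->
  separated U (pair_frame uh (ph uh)) (lambda a b c uh).
Proof.
  intros Hc HI.
  assert (Hxq := canonical_pairs_roots a b c U uh Hc HI).
  assert (HU := ir_open _ _ _ _ _ HI).
  assert (HF := frame_pair_frame U _ _ HU Hxq).
  destruct Hxq as [Sx [Sq Hxq]].
  assert (K : forall i D z, derivation U D -> U z ->
    D (uh i) z = 0 -> D (ph uh i) z = 0 -> D (lambda a b c uh i) z = 0).
  { intros i D z HD Hz E1 E2.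
    assert (L1 : has_der U D z (uh i) 0) by now split.
    assert (L2 : has_der U D z (ph uh i) 0) by now split.
    assert (N : forall n z, U z -> (uh i z ^ n)%C <> 0)
      by (intros n y Hy; now apply Cpow_nz, (ir_neq_0 _ _ _ _ _ HI)).
    assert (N2 := N 2%nat). assert (N3 := N 3%nat).
    assert (T : forall z, U z -> RtoC 2 <> 0) by (intros; apply RtoC_neq_0; lra).
    enough (H : has_der U D z (lambda a b c uh i) 0) by apply H.
    unfold lambda; cbv zeta. has_der_compute. ring. }
  intros i j z Hz Hij.
  destruct (Hxq i j z Hz) as [E1 [E2 E3]]. destruct (Hxq j i z Hz) as [E4 [E5 E6]].
  assert (Dij : delta i j = 0) by (destruct i, j; [congruence|reflexivity..|congruence]).
  assert (Dji : delta j i = 0) by (destruct i, j; [congruence|reflexivity..|congruence]).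
  split.
  - apply (K i (pair_frame uh (ph uh) (Pos j)) z); trivial.
    + apply (frame_der _ _ HF).
    + simpl. now rewrite E1.
  - apply (K i (pair_frame uh (ph uh) (Mom j)) z); trivial.
    + apply (frame_der _ _ HF).
    + simpl. now rewrite E4.
Qed.

(** * The dependence on the momenta *)

(** [Hhat1] is symmetric under exchange of the two degrees of freedom: this is the coefficient of
    [p1^2], and the swapped arguments give that of [p2^2]. *)
Definition h1_coef (b c u1 u2 : R) : R :=
  u1 ^ 3 * (b * u1 * u2 + c * (3 * u1 + u2)) / (c * (u1 - u2)).

Definition h1_free (a b c u1 u2 : R) : R :=
  - a * (b * u1 * u2 / c + 3 * (u1 + u2))
  + b ^ 2 * (u1 + u2) / (c * u1 * u2)
  + b * (u1 + 2 * u2) * (2 * u1 + u2) / (u1 ^ 2 * u2 ^ 2)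
  + c * (u1 + u2) * (u1 ^ 2 + 3 * u1 * u2 + u2 ^ 2) / (u1 ^ 3 * u2 ^ 3).

Definition h2_quad (c u1 u2 : R) : R := u1 ^ 3 * u2 ^ 3 / (c * (u1 - u2) ^ 2).

Definition h2_free (a b c u1 u2 : R) : R :=
  - a * u1 ^ 3 * u2 ^ 3 / c + b ^ 2 * u1 ^ 2 * u2 ^ 2 / (4 * c ^ 2)
  + b * (u1 + u2) * u1 * u2 / (2 * c) + (u1 + u2) ^ 2 / 4.

Definition h2_pot (a b c u1 u2 : R) : R :=
  a * (u1 - u2) + b * (1 / u1 ^ 2 - 1 / u2 ^ 2) + c * (1 / u1 ^ 3 - 1 / u2 ^ 3).

Lemma Hhat1_momenta a b c z : Hhat1 a b c z =
  h1_coef b c (u I1 z) (u I2 z) * p I1 z ^ 2 + h1_coef b c (u I2 z) (u I1 z) * p I2 z ^ 2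
  + h1_free a b c (u I1 z) (u I2 z).
Proof.
  unfold Hhat1, h1_coef, h1_free; cbv zeta.
  replace (b * u I2 z * u I1 z + c * (3 * u I2 z + u I1 z))
    with (b * u I1 z * u I2 z + c * (u I1 z + 3 * u I2 z)) by ring.
  unfold Rdiv. ring.
Qed.

Lemma Hhat2_momenta a b c z : Hhat2 a b c z =
  (h2_quad c (u I1 z) (u I2 z) * (u I1 z ^ 2 * p I1 z - u I2 z ^ 2 * p I2 z) ^ 2
    + h2_free a b c (u I1 z) (u I2 z)) * (4 / (u I1 z - u I2 z) ^ 2)
  * (h2_pot a b c (u I1 z) (u I2 z) - u I1 z ^ 3 * p I1 z ^ 2 + u I2 z ^ 3 * p I2 z ^ 2) ^ 2.
Proof.
  unfold Hhat2, h2_quad, h2_free, h2_pot; cbv zeta. unfold Rdiv. ring.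
Qed.

(* The coefficients of [k2 (k1 (m1 x - m2 y)^2 + k0) (g - n1 x^2 + n2 y^2)^2]. *)
Definition sextic_coef (k0 k1 k2 m1 m2 n1 n2 g : R) (j k : nat) : R :=
  k2 * match j, k with
  | 0%nat, 0%nat => k0 * g ^ 2
  | 2%nat, 0%nat => k1 * m1 ^ 2 * g ^ 2 - 2 * k0 * g * n1
  | 0%nat, 2%nat => k1 * m2 ^ 2 * g ^ 2 + 2 * k0 * g * n2
  | 1%nat, 1%nat => - 2 * k1 * m1 * m2 * g ^ 2
  | 4%nat, 0%nat => - 2 * k1 * m1 ^ 2 * g * n1 + k0 * n1 ^ 2
  | 0%nat, 4%nat => 2 * k1 * m2 ^ 2 * g * n2 + k0 * n2 ^ 2
  | 2%nat, 2%nat => 2 * k1 * g * (m1 ^ 2 * n2 - m2 ^ 2 * n1) - 2 * n1 * n2 * k0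
  | 3%nat, 1%nat => 4 * k1 * m1 * m2 * g * n1
  | 1%nat, 3%nat => - 4 * k1 * m1 * m2 * g * n2
  | 6%nat, 0%nat => k1 * m1 ^ 2 * n1 ^ 2
  | 0%nat, 6%nat => k1 * m2 ^ 2 * n2 ^ 2
  | 5%nat, 1%nat => - 2 * k1 * m1 * m2 * n1 ^ 2
  | 1%nat, 5%nat => - 2 * k1 * m1 * m2 * n2 ^ 2
  | 4%nat, 2%nat => k1 * (m2 ^ 2 * n1 ^ 2 - 2 * m1 ^ 2 * n1 * n2)
  | 2%nat, 4%nat => k1 * (m1 ^ 2 * n2 ^ 2 - 2 * m2 ^ 2 * n1 * n2)
  | 3%nat, 3%nat => 4 * k1 * m1 * m2 * n1 * n2
  | _, _ => 0
  end.

Lemma Hhat2_polynomial a b c : c <> 0 -> polynomial_in_momenta 6 (Hhat2 a b c).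
Proof.
  intros Hc.
  exists (fun j k w => let u1 := fst w in let u2 := snd w in
    sextic_coef (h2_free a b c u1 u2) (h2_quad c u1 u2) (4 / (u1 - u2) ^ 2)
      (u1 ^ 2) (u2 ^ 2) (u1 ^ 3) (u2 ^ 3) (h2_pot a b c u1 u2) j k).
  split; intros z Hz.
  - rewrite Hhat2_momenta. cbv beta zeta.
    change (fst (fst z)) with (u I1 z). change (snd (fst z)) with (u I2 z).
    generalize (h2_free a b c (u I1 z) (u I2 z)) (h2_quad c (u I1 z) (u I2 z))
      (4 / (u I1 z - u I2 z) ^ 2) (u I1 z ^ 2) (u I2 z ^ 2) (u I1 z ^ 3) (u I2 z ^ 3)
      (h2_pot a b c (u I1 z) (u I2 z)) (p I1 z) (p I2 z).
    intros. unfold sextic_coef. simpl. ring.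
  (* The coefficient of [p1^6] is [k2 k1 m1^2 n1^2], a product of quantities that are nonzero at
     regular points. *)
  - exists 6%nat. split; [lia|]. cbv beta zeta.
    change (fst (fst z)) with (u I1 z). change (snd (fst z)) with (u I2 z).
    destruct Hz as [H12 [H1 H2]].
    unfold sextic_coef, h2_quad. cbn [Nat.sub].
    assert (u I1 z - u I2 z <> 0) by lra.
    repeat (apply Rmult_integral_contrapositive_currified || apply Rinv_neq_0_compat
      || apply pow_nonzero || unfold Rdiv); trivial; lra.
Qed.

(** * Functional independence of the two Hamiltonians *)

Lemma sextic_nonzero_near (f : R -> R) (c0 c1 c2 c3 c4 c5 c6 t0 eps : R) :
  0 < eps -> c6 <> 0 ->
  (forall t, f t = c6 * t ^ 6 + c5 * t ^ 5 + c4 * t ^ 4 + c3 * t ^ 3 + c2 * t ^ 2 + c1 * t + c0) ->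
  exists t, Rabs (t - t0) < eps /\ f t <> 0.
Proof.
  intros He Hc Hf.
  (* The seven nodes [t0 + k h], [k <= 6], stay within [eps] of [t0]. They cannot all be zeros of
     [f], since a sixth difference annihilates the lower-degree terms and leaves [720 c6 h^6]. *)
  set (h := eps / 7).
  assert (Hh : 0 < h) by (unfold h; lra).
  (* Sixth finite difference. *)
  assert (HD : f t0 - 6 * f (t0 + h) + 15 * f (t0 + 2 * h) - 20 * f (t0 + 3 * h)
    + 15 * f (t0 + 4 * h) - 6 * f (t0 + 5 * h) + f (t0 + 6 * h) = 720 * c6 * h ^ 6)
    by (rewrite !Hf; ring).
  assert (Hn : 720 * c6 * h ^ 6 <> 0).
  { apply Rmult_integral_contrapositive_currified; [lra|]. apply pow_nonzero; lra. }
  assert (Hk : forall k, 0 <= k <= 6 -> Rabs (t0 + k * h - t0) < eps).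
  { intros k Hk. replace (t0 + k * h - t0) with (k * h) by ring.
    rewrite Rabs_pos_eq by nra. unfold h; nra. }
  destruct (Req_dec (f (t0 + 0 * h)) 0) as [E0|];
    [|now exists (t0 + 0 * h); split; [apply Hk; lra|]].
  destruct (Req_dec (f (t0 + 1 * h)) 0) as [E1|];
    [|now exists (t0 + 1 * h); split; [apply Hk; lra|]].
  destruct (Req_dec (f (t0 + 2 * h)) 0) as [E2|];
    [|now exists (t0 + 2 * h); split; [apply Hk; lra|]].
  destruct (Req_dec (f (t0 + 3 * h)) 0) as [E3|];
    [|now exists (t0 + 3 * h); split; [apply Hk; lra|]].
  destruct (Req_dec (f (t0 + 4 * h)) 0) as [E4|];
    [|now exists (t0 + 4 * h); split; [apply Hk; lra|]].
  destruct (Req_dec (f (t0 + 5 * h)) 0) as [E5|];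
    [|now exists (t0 + 5 * h); split; [apply Hk; lra|]].
  destruct (Req_dec (f (t0 + 6 * h)) 0) as [E6|];
    [|now exists (t0 + 6 * h); split; [apply Hk; lra|]].
  exfalso. apply Hn. rewrite <- HD.
  rewrite Rmult_0_l, Rplus_0_r in E0. rewrite Rmult_1_l in E1.
  rewrite E0, E1, E2, E3, E4, E5, E6. ring.
Qed.

(** The bracketed factor is a quartic with leading coefficient [- k1 a2 m e1], because the term
    containing [q] has degree at most three; times [a0 + a2 t^2] it becomes a sextic. *)
Lemma minor_nonzero_near (k0 k1 m v a0 a2 e0 e1 q t0 eps : R) :
  0 < eps -> k1 <> 0 -> m <> 0 -> a2 <> 0 -> e1 <> 0 ->
  exists t, Rabs (t - t0) < eps /\
    (a0 + a2 * t ^ 2) * (- k1 * (m * t - v) * (a0 + a2 * t ^ 2) * (e1 * t + e0)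
      + (k1 * (m * t - v) ^ 2 + k0) * t * q) <> 0.
Proof.
  intros He Hk Hm Ha H1.
  set (l1 := m * e0 - v * e1).
  set (f4 := - k1 * a2 * m * e1). set (f3 := - k1 * a2 * l1 + q * k1 * m ^ 2).
  set (f2 := - k1 * (a0 * m * e1 - a2 * v * e0) - 2 * q * k1 * m * v).
  set (f1 := - k1 * a0 * l1 + q * (k1 * v ^ 2 + k0)). set (f0 := k1 * a0 * v * e0).
  apply (sextic_nonzero_near _ (a0 * f0) (a0 * f1) (a2 * f0 + a0 * f2) (a2 * f1 + a0 * f3)
    (a2 * f2 + a0 * f4) (a2 * f3) (a2 * f4)); trivial.
  - unfold f4. repeat apply Rmult_integral_contrapositive_currified; trivial. lra.
  - intros t. unfold f0, f1, f2, f3, f4, l1. ring.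
Qed.

Lemma rpartial_eq k f z g d :
  (forall t, f (set k z t) = g t) -> is_derive g (get k z) d -> rpartial k f z = d.
Proof.
  intros Hfg Hd. unfold rpartial. rewrite (Derive_ext _ _ _ Hfg). now apply is_derive_unique.
Qed.

(** Cramer's rule for the two equations with indices [k] and [l]. *)
Lemma independent_at_minor F G z k l :
  rpartial k F z * rpartial l G z - rpartial l F z * rpartial k G z <> 0 ->
  independent_at F G z.
Proof.
  intros HJ s t H. pose proof (H k) as Hk. pose proof (H l) as Hl.
  split.
  - apply (Rmult_eq_reg_r (rpartial k F z * rpartial l G z - rpartial l F z * rpartial k G z));
      trivial.
    transitivity ((s * rpartial k F z + t * rpartial k G z) * rpartial l G z
      - (s * rpartial l F z + t * rpartial l G z) * rpartial k G z); [ring|].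
    rewrite Hk, Hl. ring.
  - apply (Rmult_eq_reg_r (rpartial k F z * rpartial l G z - rpartial l F z * rpartial k G z));
      trivial.
    transitivity ((s * rpartial l F z + t * rpartial l G z) * rpartial k F z
      - (s * rpartial k F z + t * rpartial k G z) * rpartial l F z); [ring|].
    rewrite Hk, Hl. ring.
Qed.

(** The factored form matches [minor_nonzero_near] both as a function of [p1] and as a function of
    [p2]. *)
Lemma Hhat_minor a b c z :
  let u1 := u I1 z in let u2 := u I2 z in let p1 := p I1 z in let p2 := p I2 z in
  let A := h1_coef b c u1 u2 in let B := h1_coef b c u2 u1 in
  let k1 := h2_quad c u1 u2 in let k0 := h2_free a b c u1 u2 in
  let w := u1 ^ 2 * p1 - u2 ^ 2 * p2 in
  let G := h2_pot a b c u1 u2 - u1 ^ 3 * p1 ^ 2 + u2 ^ 3 * p2 ^ 2 in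
  rpartial (Mom I1) (Hhat1 a b c) z * rpartial (Mom I2) (Hhat2 a b c) z
    - rpartial (Mom I2) (Hhat1 a b c) z * rpartial (Mom I1) (Hhat2 a b c) z
  = 4 * (4 / (u1 - u2) ^ 2) * (G * (- k1 * w * G * (A * u2 ^ 2 * p1 + B * u1 ^ 2 * p2)
      + (k1 * w ^ 2 + k0) * p1 * (2 * p2 * (A * u2 ^ 3 + B * u1 ^ 3)))).
Proof.
  intros u1 u2 p1 p2 A B k1 k0 w G.
  set (k2 := 4 / (u1 - u2) ^ 2). set (g := h2_pot a b c u1 u2). set (K := h1_free a b c u1 u2).
  assert (E1 : rpartial (Mom I1) (Hhat1 a b c) z = 2 * A * p1).
  { apply rpartial_eq with (fun t => A * t ^ 2 + B * p2 ^ 2 + K).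
    - intros t. rewrite Hhat1_momenta. reflexivity.
    - change (get (Mom I1) z) with p1. auto_derive; trivial. ring. }
  assert (E2 : rpartial (Mom I2) (Hhat1 a b c) z = 2 * B * p2).
  { apply rpartial_eq with (fun t => A * p1 ^ 2 + B * t ^ 2 + K).
    - intros t. rewrite Hhat1_momenta. reflexivity.
    - change (get (Mom I2) z) with p2. auto_derive; trivial. ring. }
  assert (E3 : rpartial (Mom I1) (Hhat2 a b c) z =
    k2 * G * (2 * k1 * u1 ^ 2 * w * G - 4 * (k1 * w ^ 2 + k0) * u1 ^ 3 * p1)).
  { apply rpartial_eq with (fun t => (k1 * (u1 ^ 2 * t - u2 ^ 2 * p2) ^ 2 + k0) * k2
      * (g - u1 ^ 3 * t ^ 2 + u2 ^ 3 * p2 ^ 2) ^ 2).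
    - intros t. rewrite Hhat2_momenta. reflexivity.
    - change (get (Mom I1) z) with p1. auto_derive; trivial. unfold G, w. fold g.
      generalize k1 k2 k0 g. intros. ring. }
  assert (E4 : rpartial (Mom I2) (Hhat2 a b c) z =
    k2 * G * (- 2 * k1 * u2 ^ 2 * w * G + 4 * (k1 * w ^ 2 + k0) * u2 ^ 3 * p2)).
  { apply rpartial_eq with (fun t => (k1 * (u1 ^ 2 * p1 - u2 ^ 2 * t) ^ 2 + k0) * k2
      * (g - u1 ^ 3 * p1 ^ 2 + u2 ^ 3 * t ^ 2) ^ 2).
    - intros t. rewrite Hhat2_momenta. reflexivity.
    - change (get (Mom I2) z) with p2. auto_derive; trivial. unfold G, w. fold g.
      generalize k1 k2 k0 g. intros. ring. }
  rewrite E1, E2, E3, E4. clearbody G w A B k1 k0 k2. ring.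
Qed.

(** If both numerators vanished, their difference [2 c (u1 - u2)] would too. *)
Lemma h1_coef_neq_0 b c u1 u2 : c <> 0 -> u1 <> u2 -> u1 <> 0 -> u2 <> 0 ->
  h1_coef b c u1 u2 <> 0 \/ h1_coef b c u2 u1 <> 0.
Proof.
  intros Hc H12 H1 H2.
  assert (K : forall x y, x <> y -> x <> 0 -> b * x * y + c * (3 * x + y) <> 0 ->
    h1_coef b c x y <> 0).
  { intros x y Hxy Hx H. unfold h1_coef, Rdiv.
    apply Rmult_integral_contrapositive_currified.
    - apply Rmult_integral_contrapositive_currified; trivial. now apply pow_nonzero.
    - apply Rinv_neq_0_compat, Rmult_integral_contrapositive_currified; trivial. lra. }
  destruct (Req_dec (b * u1 * u2 + c * (3 * u1 + u2)) 0) as [E1|E1]; [|left; now apply K].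
  destruct (Req_dec (b * u2 * u1 + c * (3 * u2 + u1)) 0) as [E2|E2];
    [|right; apply K; auto].
  exfalso. apply H12. apply (Rmult_eq_reg_l (2 * c)); [|lra]. lra.
Qed.

(** A single momentum is moved inside [V], which leaves the positions and all coefficients fixed.
    The momentum chosen is one whose square has a nonzero coefficient in [Hhat1], since that
    coefficient enters the leading term of the minor. *)
Lemma Hhat_independent a b c : c <> 0 ->
  functionally_independent regular (Hhat1 a b c) (Hhat2 a b c).
Proof.
  intros Hc V HV [z Hz] Hreg.
  destruct (Hreg z Hz) as [H12 [H1 H2]].
  assert (Hd : u I1 z - u I2 z <> 0) by lra.
  assert (Hk1 : h2_quad c (u I1 z) (u I2 z) <> 0).
  { unfold h2_quad, Rdiv. apply Rmult_integral_contrapositive_currified.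
    - apply Rmult_integral_contrapositive_currified; now apply pow_nonzero.
    - apply Rinv_neq_0_compat, Rmult_integral_contrapositive_currified; trivial.
      now apply pow_nonzero. }
  assert (Hk2 : 4 * (4 / (u I1 z - u I2 z) ^ 2) <> 0).
  { apply Rmult_integral_contrapositive_currified; [lra|]. unfold Rdiv.
    apply Rmult_integral_contrapositive_currified; [lra|].
    now apply Rinv_neq_0_compat, pow_nonzero. }
  destruct (h1_coef_neq_0 b c (u I1 z) (u I2 z) Hc H12 H1 H2) as [HA|HB].
  - destruct (locally_set V (Mom I1) z HV Hz) as [eps He].
    destruct (minor_nonzero_near (h2_free a b c (u I1 z) (u I2 z))
      (h2_quad c (u I1 z) (u I2 z)) (u I1 z ^ 2) (u I2 z ^ 2 * p I2 z)
      (h2_pot a b c (u I1 z) (u I2 z) + u I2 z ^ 3 * p I2 z ^ 2) (- u I1 z ^ 3)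
      (h1_coef b c (u I2 z) (u I1 z) * u I1 z ^ 2 * p I2 z)
      (h1_coef b c (u I1 z) (u I2 z) * u I2 z ^ 2)
      (2 * p I2 z * (h1_coef b c (u I1 z) (u I2 z) * u I2 z ^ 3
        + h1_coef b c (u I2 z) (u I1 z) * u I1 z ^ 3))
      (get (Mom I1) z) eps) as [t [Ht Hn]].
    + apply cond_pos.
    + trivial.
    + now apply pow_nonzero.
    + apply Ropp_neq_0_compat. now apply pow_nonzero.
    + apply Rmult_integral_contrapositive_currified; trivial. now apply pow_nonzero.
    + exists (set (Mom I1) z t). split; [apply He; exact Ht|].
      apply independent_at_minor with (Mom I1) (Mom I2). rewrite Hhat_minor. cbv zeta.
      change (u I1 (set (Mom I1) z t)) with (u I1 z).
      change (u I2 (set (Mom I1) z t)) with (u I2 z).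
      change (p I1 (set (Mom I1) z t)) with t.
      change (p I2 (set (Mom I1) z t)) with (p I2 z).
      apply Rmult_integral_contrapositive_currified; trivial.
      intros E. apply Hn. rewrite <- E. ring.
  - destruct (locally_set V (Mom I2) z HV Hz) as [eps He].
    destruct (minor_nonzero_near (h2_free a b c (u I1 z) (u I2 z))
      (h2_quad c (u I1 z) (u I2 z)) (- u I2 z ^ 2) (- u I1 z ^ 2 * p I1 z)
      (h2_pot a b c (u I1 z) (u I2 z) - u I1 z ^ 3 * p I1 z ^ 2) (u I2 z ^ 3)
      (h1_coef b c (u I1 z) (u I2 z) * u I2 z ^ 2 * p I1 z)
      (h1_coef b c (u I2 z) (u I1 z) * u I1 z ^ 2)
      (2 * p I1 z * (h1_coef b c (u I1 z) (u I2 z) * u I2 z ^ 3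
        + h1_coef b c (u I2 z) (u I1 z) * u I1 z ^ 3))
      (get (Mom I2) z) eps) as [t [Ht Hn]].
    + apply cond_pos.
    + trivial.
    + apply Ropp_neq_0_compat. now apply pow_nonzero.
    + now apply pow_nonzero.
    + apply Rmult_integral_contrapositive_currified; trivial. now apply pow_nonzero.
    + exists (set (Mom I2) z t). split; [apply He; exact Ht|].
      apply independent_at_minor with (Mom I1) (Mom I2). rewrite Hhat_minor. cbv zeta.
      change (u I1 (set (Mom I2) z t)) with (u I1 z).
      change (u I2 (set (Mom I2) z t)) with (u I2 z).
      change (p I1 (set (Mom I2) z t)) with (p I1 z).
      change (p I2 (set (Mom I2) z t)) with t.
      apply Rmult_integral_contrapositive_currified; trivial.
      intros E. apply Hn. rewrite <- E. ring.
Qed.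

Theorem mainTheorem5 (a b c : R) (hc : c <> 0) :
  (forall (U : phase -> Prop) (uh : idx -> phase -> C),
     root_branches a b c U uh ->
     (forall i j z, U z ->
        canonical (uh i) (ph uh j) z = delta i j /\
        canonical (uh i) (uh j) z = 0 /\
        canonical (ph uh i) (ph uh j) z = 0) /\
     (forall z, U z ->
        RtoC (Hhat1 a b c z)
          = (2 * (lambda a b c uh I1 z + lambda a b c uh I2 z))%C /\
        RtoC (Hhat2 a b c z)
          = (4 * (lambda a b c uh I1 z - lambda a b c uh I2 z) ^ 2)%C) /\
     ((forall i z, U z -> lambda a b c uh i z <> 0) ->
      exists br' : bracket,
        is_poisson_bracket U br' /\
        (forall i j z, U z ->
           br' (uh i) (ph uh j) z = (/ lambda a b c uh i z * delta i j)%C /\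
           br' (uh i) (uh j) z = 0 /\
           br' (ph uh i) (ph uh j) z = 0) /\
        bi_hamiltonian U canonical br'
          (hamiltonian_field canonical (fun z => RtoC (Hhat1 a b c z))))) /\
  integrable_with regular (Hhat1 a b c) (Hhat2 a b c) /\
  polynomial_in_momenta 6 (Hhat2 a b c).
Proof.
  split; [|split; [split|]].
  - intros U uh HR.
    assert (HI := root_branches_inverse a b c U uh hc HR).
    assert (Hxq := canonical_pairs_roots a b c U uh hc HI).
    split; [apply Hxq|split].
    + intros z Hz. now apply Hhat_lambda with U.
    (* The witness, fixed by the next line, is the frame bracket of the new canonical pairs with
       weights [1 / lambda i]. *)
    + intros H0. eexists.
      apply (bi_hamiltonian_separated U uh (ph uh) (lambda a b c uh)); trivial.
      * apply (ir_open _ _ _ _ _ HI).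
      * intros i. now apply smooth_lambda.
      * now apply separated_lambda.
      * intros z Hz. now apply (Hhat_lambda a b c U uh z hc HI Hz).
  - now apply Hhat_independent.
  - now apply Hhat_involution.
  - now apply Hhat2_polynomial.
Qed.
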